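(* Consider $\min_{x\in X}\Psi(x)=f(x)+h(x)+\chi(x)$ and suppose: (i) $\chi$ is $\mu$-strongly convex ($\mu>0$); (ii) the convex function $h:X\to\mathbb R$ admits a family of continuously differentiable convex functions $\{h_\eta\}_{\eta>0}$ and constants $B_h,C_h>0$ such that for all $x,z\in X$ and $0<\eta'\le\eta$, $$h_\eta(x)\le h(x)\le h_\eta(x)+B_h\eta,\quad \|\nabla h_\eta(x)-\nabla h_\eta(z)\|_*\le\frac{C_h}{\eta}\|x-z\|,\quad 0\le h_{\eta'}(x)-h_\eta(x)\le B_h(\eta-\eta');$$ (iii) $f:X\to\mathbb R$ is smooth and convex with $f(x)\le f(y)+\langle\nabla f(y),x-y\rangle+\frac L2\|x-y\|^2$ for all $x,y\in X$, for some $L>0$; (iv) the points $\underline u_{k,t}$ and $u_{k,t-1}$ are $\mathcal F_{k,t-1}$-measurable, $\xi_{k,t}$ is sampled independently of $\mathcal F_{k,t-1}$, and there is a constant $\sigma\ge0$, uniform over the smoothing schedule, with $\mathbb E[H_{\eta_k}(\underline u_{k,t},\xi_{k,t})\mid\mathcal F_{k,t-1}]=\nabla h_{\eta_k}(\underline u_{k,t})$ and $\mathbb E[\|H_{\eta_k}(\underline u_{k,t},\xi_{k,t})-\nabla h_{\eta_k}(\underline u_{k,t})\|_*^2\mid\mathcal F_{k,t-1}]\le\sigma^2$. For every outer iteration $k$ define $$\widehat L=\max\{L,4\nu\mu\},\quad\lambda_k=\lambda:=\sqrt{\frac{\nu\mu}{\widehat L}},\quad\gamma_k=\gamma:=\frac\lambda2,\quad\beta_k=\beta:=\frac{\widehat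 L\gamma}{\nu}.$$ Let $x^*$ be a minimizer of $\Psi$ over $X$, $\Psi^*=\Psi(x^* )$, and let $\Delta_0>0$ satisfy $$\Delta_0\ge\Psi(\bar x_0)-\Psi^*+\lambda(\beta+\mu)V(x_0,x^* ).$$ Let $0<\epsilon<8\Delta_0$ and set $$N=\left\lceil\frac{2\log(8\Delta_0/\epsilon)}{-\log(1-\gamma)}\right\rceil,\quad\eta_k=\frac{\Delta_0}{B_h}(1-\gamma)^{k/2},\quad L_{\eta_k}=\frac{C_h}{\eta_k},$$ $$T_k^{\rm g}:=\left\lceil\frac{\log(1/2)}{\log\Bigl(1-\frac14\sqrt{\frac{\widehat L}{\max\{\widehat L,L_{\eta_k}\}}}\Bigr)}\right\rceil,\quad T_k^{\rm s}=\left\lceil\frac{8\sigma^2(\log 2)\,(1-(1-\gamma)^{N/2})}{5\widehat L\epsilon(1-\sqrt{1-\gamma})}(1-\gamma)^{(N-k)/2}\right\rceil,$$ $$T_k:=\max\{T_k^{\rm g},T_k^{\rm s}\},\quad\alpha_{k,t}=\alpha_k=1-2^{-1/T_k},\quad p_{k,t}=p_k=\frac{1-\alpha_k}{\alpha_k},\quad q_{k,t}=p_k\mu .$$ Let $\{\bar x_k\}$ be generated by the RF-ASSGS algorithm (described in the context) with these parameters. Then $$\mathbb E[\Psi(\bar x_N)-\Psi(x^* )]\le\epsilon .$$ Moreover, let $N_f$ denote the number of evaluations of $\nabla f$ and $N_H$ the number of stochastic-oracle evaluations. Then $$N_f=\mathcal O\left(\left[1+\sqrt{\frac L{\nu\mu}}\right]\left[1+\log\max\left\{\frac{\Delta_0}\epsilon,1\right\}\right]\right),\qquad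 N_H=\mathcal O\left(N_f+\sqrt{\frac{B_hC_h}{\nu\mu\epsilon}}+\frac{\sigma^2}{\nu\mu\epsilon}\right).$$ In the exact-oracle case $\sigma=0$, the number of evaluations of the smoothed gradients is $$N_{\nabla h_\eta}=\mathcal O\left(N_f+\sqrt{\frac{B_hC_h}{\nu\mu\epsilon}}\right).$$ Here $\mathcal O(\cdot)$ hides absolute constants only.
   Context: $X\subseteq\mathbb R^n$ is a closed convex set, and $\chi:X\to\mathbb R$ is convex and simple enough that the minimization subproblems below can be solved exactly. $\|\cdot\|$ is an arbitrary norm on $\mathbb R^n$ with dual norm $\|\cdot\|_*$. $\chi$ is $\mu$-strongly convex if $\chi(z)\ge\chi(x)+\langle\chi'(x),z-x\rangle+\frac\mu2\|z-x\|^2$ for all $x,z\in X$ and $\chi'(x)\in\partial\chi(x)$. $\omega:X\to\mathbb R$ is a distance generating function with modulus $\nu>0$: continuously differentiable with $\langle x-z,\nabla\omega(x)-\nabla\omega(z)\rangle\ge\nu\|x-z\|^2$ for all $x,z\in X$. The Bregman distance is $V(x,z)=\omega(z)-\omega(x)-\langle\nabla\omega(x),z-x\rangle$, so $V(x,z)\ge\frac\nu2\|x-z\|^2$; it is assumed throughout that also $V(x,z)\le\frac12\|x-z\|^2$ for all $x,z\in X$. $l_f(y,u)=f(y)+\langle\nabla f(y),u-y\rangle$ and $\tilde l_{h_{\eta_k}}(\underline u_{k,t},u)=h_{\eta_k}(\underline u_{k,t})+\langle H_{\eta_k}(\underline u_{k,t},\xi_{k,t}),u-\underline u_{k,t}\rangle$,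 where $H_{\eta}(\cdot,\xi)$ is the output of the (stochastic or exact) first-order oracle for $h_\eta$. $\mathcal F_{k,t-1}$ denotes the $\sigma$-field generated by all oracle samples drawn before $\xi_{k,t}$. RF-ASSGS algorithm. Start from $x_0\in X$ with $\bar x_0=x_0$. For $k=1,\dots,N$: set $\underline x_k=(1-\gamma_k)\bar x_{k-1}+\gamma_kx_{k-1}$, $u_{k,0}=x_{k-1}$, $\tilde u_{k,0}=\bar x_{k-1}$; for $t=1,\dots,T_k$ compute $$\underline u_{k,t}=(1-\lambda_k)\bar x_{k-1}+\lambda_k(1-\alpha_{k,t})\tilde u_{k,t-1}+\lambda_k\alpha_{k,t}u_{k,t-1},$$ $$u_{k,t}=\arg\min_{u\in X}\bigl\{l_f(\underline x_k,u)+\tilde l_{h_{\eta_k}}(\underline u_{k,t},u)+\chi(u)+\beta_kV(x_{k-1},u)+(\beta_kp_{k,t}+q_{k,t})V(u_{k,t-1},u)\bigr\},$$ $$\tilde u_{k,t}=(1-\alpha_{k,t})\tilde u_{k,t-1}+\alpha_{k,t}u_{k,t};$$ then set $x_k=u_{k,T_k}$, $\tilde x_k=\tilde u_{k,T_k}$, $\bar x_k=(1-\lambda_k)\bar x_{k-1}+\lambda_k\tilde x_k$. Thus $\nabla f$ is evaluated once per outer iteration ($N_f=N$) and the oracle for $h_{\eta_k}$ is called once per inner iteration ($N_H=\sum_{k=1}^NT_k$; in the exact case $\sigma=0$ this count is $N_{\nabla h_\eta}$). *)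

(* Defs.v *)
(* MathComp + MathComp-Analysis; R^n is 'rV[R]_n for R : realType. *)
From mathcomp Require Export all_boot all_order all_algebra.
From mathcomp Require Export all_classical all_reals all_analysis.
Export numFieldNormedType.Exports.
Export Order.TTheory GRing.Theory Num.Theory.

Set Implicit Arguments.
Unset Strict Implicit.
Unset Printing Implicit Defensive.

Local Open Scope classical_set_scope.
Local Open Scope ring_scope.

Section Euclidean.
Context {R : realType} {n : nat}.
Local Notation V := 'rV[R]_n.
Implicit Types (X : set V) (f : V -> R) (g : V -> V) (nrm : V -> R).

Definition dotp (x y : V) : R := \sum_i x 0 i * y 0 i.

Definition is_norm nrm : Prop :=
  [/\ forall x, nrm x = 0 -> x = 0,
      forall x y, nrm (x + y) <= nrm x + nrm y &
      forall a x, nrm (a *: x) = `|a| * nrm x].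

Definition dual_norm nrm (s : V) : R :=
  sup [set dotp s x | x in [set x | nrm x <= 1]].

(* X may have empty interior and f is only meaningful on X, so g is a gradient
   of f relative to X: f z - f x - <g x, z - x> = o(|z - x|) as z -> x inside X.
   At interior points of X this is the Frechet gradient. The library norm
   `| _ | is equivalent to any other norm on R^n. *)
Definition is_gradient X f g : Prop :=
  forall x, X x -> forall e : R, 0 < e ->
    \forall z \near within X (nbhs x),
      `|f z - f x - dotp (g x) (z - x)| <= e * `|z - x|.

Definition is_C1 X f g : Prop :=
  is_gradient X f g /\ {within X, continuous g}.

Definition is_argmin X f (u : V) : Prop :=
  X u /\ forall v, X v -> f u <= f v.

(* Subdifferential of f extended by +oo outside X. *)
Definition subdiff X f (x : V) : set V :=
  [set s | forall z, X z -> f x + dotp s (z - x) <= f z].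

Definition strongly_convex nrm X (mu : R) f : Prop :=
  forall x z s, X x -> X z -> subdiff X f x s ->
    f x + dotp s (z - x) + mu / 2 * nrm (z - x) ^+ 2 <= f z.

Definition is_dgf nrm X (nu : R) (om : V -> R) (gom : V -> V) : Prop :=
  [/\ 0 < nu, is_C1 X om gom &
      forall x z, X x -> X z ->
        nu * nrm (x - z) ^+ 2 <= dotp (x - z) (gom x - gom z)].

Definition bregman (om : V -> R) (gom : V -> V) (x z : V) : R :=
  om z - om x - dotp (gom x) (z - x).

(* The value of the affine function a + <s, . - y> at u. *)
Definition affine_model (a : R) (s y u : V) : R := a + dotp s (u - y).

(* heta eta is the smooth approximation of h with parameter eta, and gheta eta
   is its gradient. *)
Record smooth_approx nrm X (h : V -> R) (heta : R -> V -> R)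
    (gheta : R -> V -> V) (Bh Ch : R) : Prop := SmoothApprox {
  sa_convex : forall eta, 0 < eta -> convex_function (E := V) X (heta eta);
  sa_C1 : forall eta, 0 < eta -> is_C1 X (heta eta) (gheta eta);
  sa_approx : forall eta x, 0 < eta -> X x ->
    heta eta x <= h x <= heta eta x + Bh * eta;
  sa_lipschitz : forall eta x z, 0 < eta -> X x -> X z ->
    dual_norm nrm (gheta eta x - gheta eta z) <= Ch / eta * nrm (x - z);
  sa_monotone : forall eta eta' x, 0 < eta' -> eta' <= eta -> X x ->
    0 <= heta eta' x - heta eta x <= Bh * (eta - eta') }.

(* One sample path of the algorithm. The oracle returns H eta y s at the point
   y for the sample s, and xi k t is the sample of inner iteration (k, t). The
   names uund and xund stand for the underlined iterates, util for u-tilde and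
   xbar for x-bar; x-tilde_k is util k (T k). *)
Record RF_ASSGS {Xi : Type} X (f : V -> R) (gf : V -> V)
    (heta : R -> V -> R) (H : R -> V -> Xi -> V) (chi om : V -> R) (gom : V -> V)
    (gamma lambda beta eta : nat -> R) (alpha p q : nat -> nat -> R)
    (N : nat) (T : nat -> nat) (xi : nat -> nat -> Xi) (x0 : V)
    (x xbar xund : nat -> V) (u util uund : nat -> nat -> V) : Prop :=
  RFASSGS {
  alg_x0 : X x0 /\ x 0%N = x0;
  alg_xbar0 : xbar 0%N = x0;
  alg_xund : forall k, (1 <= k <= N)%N ->
    xund k = (1 - gamma k) *: xbar k.-1 + gamma k *: x k.-1;
  alg_u0 : forall k, (1 <= k <= N)%N -> u k 0%N = x k.-1;
  alg_util0 : forall k, (1 <= k <= N)%N -> util k 0%N = xbar k.-1;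
  alg_uund : forall k t, (1 <= k <= N)%N -> (1 <= t <= T k)%N ->
    uund k t = (1 - lambda k) *: xbar k.-1
               + (lambda k * (1 - alpha k t)) *: util k t.-1
               + (lambda k * alpha k t) *: u k t.-1;
  alg_u : forall k t, (1 <= k <= N)%N -> (1 <= t <= T k)%N ->
    is_argmin X (fun v =>
        affine_model (f (xund k)) (gf (xund k)) (xund k) v
        + affine_model (heta (eta k) (uund k t))
            (H (eta k) (uund k t) (xi k t)) (uund k t) v
        + chi v
        + beta k * bregman om gom (x k.-1) v
        + (beta k * p k t + q k t) * bregman om gom (u k t.-1) v)
      (u k t);
  alg_util : forall k t, (1 <= k <= N)%N -> (1 <= t <= T k)%N ->
    util k t = (1 - alpha k t) *: util k t.-1 + alpha k t *: u k t;
  alg_x : forall k, (1 <= k <= N)%N -> x k = u k (T k);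
  alg_xbar : forall k, (1 <= k <= N)%N ->
    xbar k = (1 - lambda k) *: xbar k.-1 + lambda k *: util k (T k) }.

End Euclidean.

Section Stochastic.
Context {d : measure_display} {Omega : measurableType d} {R : realType}.
Variable P : probability Omega R.
Implicit Type F : set (set Omega).

(* Borel measurability with respect to F, which is meant to be a sigma-algebra;
   open sets generate the Borel sets. *)
Definition measurable_wrt F {W : topologicalType} (Y : Omega -> W) : Prop :=
  forall U : set W, open U -> F (Y @^-1` U).

(* Y is a version of E[Z | F]. *)
Definition is_condexp F (Z Y : Omega -> R) : Prop :=
  [/\ P.-integrable setT (EFin \o Z), P.-integrable setT (EFin \o Y),
      measurable_wrt F Y &
      forall A, F A ->
        (\int[P]_(w in A) (Z w)%:E = \int[P]_(w in A) (Y w)%:E)%E].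

Definition is_condexp_rV {n} F (Z Y : Omega -> 'rV[R]_n) : Prop :=
  forall i, is_condexp F (fun w => Z w 0 i) (fun w => Y w 0 i).

Context {d' : measure_display} {Xi : measurableType d'}.

Definition independent_of F (s : Omega -> Xi) : Prop :=
  forall A B, F A -> measurable B ->
    P (A `&` s @^-1` B) = (P A * P (s @^-1` B))%E.

(* The sigma-algebra F_{k,t-1} generated by the samples drawn strictly before
   the sample xi k t, outer iteration j drawing the samples xi j 1, xi j 2,
   up to xi j (T j). *)
Definition history (T : nat -> nat) (xi : nat -> nat -> Omega -> Xi)
    (k t : nat) : set (set Omega) :=
  <<s [set A | exists j s B,
        [/\ (1 <= j)%N, (1 <= s <= T j)%N,
            (j < k)%N \/ (j = k /\ (s < t)%N),
            measurable B & A = xi j s @^-1` B]] >>.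

(* The trajectory is given by u and uund as random iterates. *)
Record stochastic_oracle {n : nat} (nrm : 'rV[R]_n -> R)
    (gheta : R -> 'rV[R]_n -> 'rV[R]_n) (H : R -> 'rV[R]_n -> Xi -> 'rV[R]_n)
    (eta : nat -> R) (N : nat) (T : nat -> nat)
    (xi : nat -> nat -> Omega -> Xi) (u uund : nat -> nat -> Omega -> 'rV[R]_n)
    (sigma : R) : Prop := StochasticOracle {
  so_measurable : forall k t, (1 <= k <= N)%N -> (1 <= t <= T k)%N ->
    measurable_fun setT (xi k t);
  so_adapted : forall k t, (1 <= k <= N)%N -> (1 <= t <= T k)%N ->
    measurable_wrt (history T xi k t) (uund k t) /\
    measurable_wrt (history T xi k t) (u k t.-1);
  so_independent : forall k t, (1 <= k <= N)%N -> (1 <= t <= T k)%N ->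
    independent_of (history T xi k t) (xi k t);
  so_unbiased : forall k t, (1 <= k <= N)%N -> (1 <= t <= T k)%N ->
    is_condexp_rV (history T xi k t)
      (fun w => H (eta k) (uund k t w) (xi k t w))
      (fun w => gheta (eta k) (uund k t w));
  so_variance : forall k t, (1 <= k <= N)%N -> (1 <= t <= T k)%N ->
    exists2 Y : Omega -> R,
      is_condexp (history T xi k t)
        (fun w => dual_norm nrm (H (eta k) (uund k t w) (xi k t w)
                                 - gheta (eta k) (uund k t w)) ^+ 2) Y &
      {ae P, forall w, Y w <= sigma ^+ 2} }.

End Stochastic.

(* Ceiling as a natural number, meant for nonnegative arguments. *)
Definition nceil {R : realType} (x : R) : nat := `|Num.ceil x|%N.

(* Main.v *)
(* Inside outer iteration k the functions f (linearized), h_eta and chi are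
   majorized at y_t = (1 - lambda) xbar_{k-1} + lambda util_t. The prox-step
   inequality, with mu |.|^2 / 2 >= mu V, makes
     m(y_t) - (1 - lambda) m(xbar_{k-1}) - lambda m(v)
       + lambda (beta + mu) V(u_t, v)
   contract by 1 - alpha_k at each inner step, up to beta V(x_{k-1}, .) and to a
   noise term; the rule for T_k^g gives C_h / eta_k alpha_k^2 <= Lhat / 16,
   which absorbs the curvature of h_eta and leaves room for Young's inequality
   on the noise. Since (1 - alpha_k)^T_k = 1/2, an outer iteration contracts by
   1 - lambda / 2 = 1 - gamma, and the dropped terms beta V(x_{k-1}, u_t)
   exactly pay for the linearization of f. With the bias B_h eta_k
   proportional to r^k, r = sqrt (1 - gamma), the recursion for the gap is
   solved exactly by a multiple of r^k, and the rule for T_k^s keeps the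
   accumulated variance below epsilon / 2.

   The term <error, x* - u_{t-1}> has mean zero only if it is integrable. So
   the bound above is proved for every t <= T_k, not only for t = T_k: it yields
   by induction an integrable majorant of |u_t - x*|^2. *)

(* The parameters interlock as follows. The entry 4 nu mu of Lhat forces lambda <= 1/2, hence gamma
   <= 1/4, and the formula for beta gives gamma beta = mu / 4; together 2 gamma (beta + mu) <= mu,
   which is exactly the condition for the coefficient of V to contract by 1 - gamma along with the
   function values. The choice gamma = lambda / 2 is tied to (1 - alpha_k)^T_k = 1/2: at t = T_k the
   vector y_t - [xund k] then has no component along xbar_{k-1} - x_{k-1}. The number T_k controls
   alpha_k in two ways: T_k >= T_k^g keeps it below the curvature threshold, and alpha_k T_k <= log
   2 turns T_k >= T_k^s into a bound on the variance.

   Measurability shapes the probabilistic half. The oracle hypotheses give it for the points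
   u_{k,t-1} and [uund k t], but Psi(xbar_N) is not assumed measurable. All estimates are therefore
   made path by path and then carried to integrable majorants ([dominated]); conditional
   expectations enter only for the product of an oracle error with a point fixed before the sample
   is drawn. *)
Require Import Defs.
From mathcomp Require Import measurable_realfun ring lra.

Set Implicit Arguments.
Unset Strict Implicit.
Unset Printing Implicit Defensive.
Import HBNNSimple.

Local Open Scope classical_set_scope.
Local Open Scope ring_scope.

(** * Norms on R^n *)

Section Dot.
Context {R : realType} {n : nat}.
Implicit Types (x y z s : 'rV[R]_n) (a : R).

Lemma dotpDl x y z : dotp (x + y) z = dotp x z + dotp y z.
Proof. by rewrite /dotp -big_split; apply: eq_bigr => i _; rewrite mxE mulrDl. Qed.

Lemma dotpDr x y z : dotp x (y + z) = dotp x y + dotp x z.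
Proof. by rewrite /dotp -big_split; apply: eq_bigr => i _; rewrite mxE mulrDr. Qed.

Lemma dotpZl a x z : dotp (a *: x) z = a * dotp x z.
Proof. by rewrite /dotp mulr_sumr; apply: eq_bigr => i _; rewrite mxE mulrA. Qed.

Lemma dotpZr a x z : dotp x (a *: z) = a * dotp x z.
Proof. by rewrite /dotp mulr_sumr; apply: eq_bigr => i _; rewrite mxE mulrCA. Qed.

Lemma dotpC x y : dotp x y = dotp y x.
Proof. by apply: eq_bigr => i _; rewrite mulrC. Qed.

Lemma dotpNl x z : dotp (- x) z = - dotp x z.
Proof. by rewrite -scaleN1r dotpZl mulN1r. Qed.

Lemma dotpNr x z : dotp x (- z) = - dotp x z.
Proof. by rewrite -scaleN1r dotpZr mulN1r. Qed.

Lemma dotpBl x y z : dotp (x - y) z = dotp x z - dotp y z.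
Proof. by rewrite dotpDl dotpNl. Qed.

Lemma dotpBr x y z : dotp x (y - z) = dotp x y - dotp x z.
Proof. by rewrite dotpDr dotpNr. Qed.

Definition dotpE := (dotpDl, dotpDr, dotpZl, dotpZr, dotpNl, dotpNr).

Lemma dotp_delta x i : dotp x (delta_mx 0 i) = x 0 i.
Proof.
rewrite /dotp (bigD1 i)//= big1 ?addr0 => [|j ji]; rewrite mxE eqxx/=.
  by rewrite eqxx mulr1.
by rewrite (negbTE ji) mulr0.
Qed.

End Dot.

Section Norm.
Context {R : realType} {n : nat} (nrm : 'rV[R]_n -> R).
Hypothesis nrmP : is_norm nrm.
Implicit Types (x y z s : 'rV[R]_n) (a : R).

Lemma nrm_le_add x y : nrm (x + y) <= nrm x + nrm y.
Proof. by case: nrmP. Qed.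

Lemma nrmZ a x : nrm (a *: x) = `|a| * nrm x.
Proof. by case: nrmP. Qed.

Lemma nrm0 : nrm 0 = 0.
Proof. by rewrite -(scale0r 0) nrmZ normr0 mul0r. Qed.

Lemma nrmN x : nrm (- x) = nrm x.
Proof. by rewrite -scaleN1r nrmZ normrN1 mul1r. Qed.

Lemma nrm_ge0 x : 0 <= nrm x.
Proof. by have := nrm_le_add x (- x); rewrite subrr nrm0 nrmN; lra. Qed.

Lemma nrm_sub x y : nrm (x - y) = nrm (y - x).
Proof. by rewrite -opprB nrmN. Qed.

Lemma nrm_eq0 x : nrm x = 0 -> x = 0.
Proof. by case: nrmP => + _ _; apply. Qed.

Lemma nrm_le_sum x : nrm x <= \sum_i `|x 0 i| * nrm (delta_mx 0 i).
Proof.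
have -> : nrm x = nrm (\sum_i x 0 i *: delta_mx 0 i) by rewrite -row_sum_delta.
elim/big_ind2: _ => [|a x1 b x2 h1 h2|i _]; first by rewrite nrm0.
  by apply: le_trans (nrm_le_add _ _) _; lra.
by rewrite nrmZ.
Qed.

Lemma coord_le_norm x i : `|x 0 i| <= `|x|.
Proof.
rewrite [leRHS]/Num.Def.normr/= mx_normrE.
by apply/bigmax_geP; right => /=; exists (0, i).
Qed.

Lemma nrm_le_norm : exists2 K : R, 0 <= K & forall x, nrm x <= K * `|x|.
Proof.
exists (\sum_i nrm (delta_mx 0 i)); first by apply: sumr_ge0 => i _; apply: nrm_ge0.
move=> x; apply: le_trans (nrm_le_sum x) _; rewrite mulr_suml; apply: ler_sum => i _.
by rewrite mulrC ler_wpM2l ?nrm_ge0// coord_le_norm.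
Qed.

Lemma nrm_dist x y : `|nrm x - nrm y| <= nrm (x - y).
Proof.
have := nrm_le_add (x - y) y; have := nrm_le_add (y - x) x.
rewrite !subrK (nrm_sub y) ler_norml; lra.
Qed.

Lemma nrm_continuous : continuous nrm.
Proof.
have [K K0 hK] := nrm_le_norm.
move=> x; apply/(@cvgrPdist_le _ _ _ (nbhs x)) => /= e e0.
have K1 : 0 < K + 1 by lra.
near=> y.
apply: (le_trans (nrm_dist _ _)); apply: (le_trans (hK _)).
apply: (@le_trans _ _ ((K + 1) * `|x - y|)); first by rewrite ler_wpM2r//; lra.
rewrite mulrC -ler_pdivlMr//.
near: y; apply/nbhs_ballP; exists (e / (K + 1)); first exact: divr_gt0.
by move=> y; rewrite -ball_normE /ball_ /= => /ltW.
Unshelve. all: by end_near. Qed.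

(** By compactness: [nrm] is continuous and nonzero on the unit sphere of the library norm, so its
    inverse is bounded there; homogeneity does the rest. *)
Lemma norm_le_nrm : exists2 K : R, 0 < K & forall x, `|x| <= K * nrm x.
Proof.
pose S : set 'rV[R]_n := [set x | `|x| = 1].
have cS : compact S.
  apply: bounded_closed_compact.
    by exists 1; split=> // M M1 x /= ->; exact: ltW.
  rewrite (_ : S = (fun x : 'rV[R]_n => `|x|) @^-1` [set 1])//.
  apply: closed_comp; last exact: closed_eq.
  by move=> x _; exact: norm_continuous.
have nS x : S x -> nrm x != 0.
  move=> Sx; apply/eqP => /nrm_eq0 x0; move: Sx.
  by rewrite /S/= x0 normr0 => /eqP; rewrite eq_sym oner_eq0.
have cf : {within S, continuous (fun x => (nrm x)^-1)}.
  apply: continuous_in_subspaceT => x /set_mem Sx.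
  apply: (@cvgV _ _ (nbhs x) _ nrm (nrm x)); first exact: nS.
  exact: nrm_continuous.
have /compact_bounded[M [_ hM]] := continuous_compact cf cS.
pose K := Num.max 1 (M + 1).
have K0 : 0 < K by rewrite lt_max ltr01.
exists K => // x.
have [->|x0] := eqVneq x 0; first by rewrite normr0 mulr_ge0 ?nrm_ge0 ?ltW.
have nx : 0 < `|x| by rewrite normr_gt0.
have Sx : S (`|x|^-1 *: x) by rewrite /S/= normrZ normfV normr_id mulVf ?gt_eqF.
have := hM K; rewrite lt_max ltrDl ltr01 orbT => /(_ isT).
move=> /(_ (nrm (`|x|^-1 *: x))^-1) /= h.
have {h} : `|(nrm (`|x|^-1 *: x))^-1| <= K by apply: h; exists (`|x|^-1 *: x).
rewrite ger0_norm ?invr_ge0 ?nrm_ge0// nrmZ ger0_norm ?invr_ge0// invfM invrK.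
rewrite ler_pdivrMr// lt_neqAle nrm_ge0 andbT eq_sym.
by apply: contra_neq x0 => /nrm_eq0.
Qed.

Lemma dotp_le_norm s x : dotp s x <= (\sum_i `|s 0 i|) * `|x|.
Proof.
rewrite mulr_suml; apply: ler_sum => i _; apply: le_trans (ler_norm _) _.
by rewrite normrM ler_wpM2l// coord_le_norm.
Qed.

Let ball_dotp s := [set dotp s x | x in [set x | nrm x <= 1]].

(** [sup] returns a default value on unbounded sets, so [dual_norm] carries information only once
    this is known. *)
Lemma dual_ball_has_sup s : has_sup (ball_dotp s).
Proof.
have [K K0 hK] := norm_le_nrm.
split; first by exists (dotp s 0), 0 => //=; rewrite nrm0.
exists ((\sum_i `|s 0 i|) * K) => _ [x /= x1 <-].
apply: le_trans (dotp_le_norm _ _) _; rewrite ler_wpM2l ?sumr_ge0//.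
by apply: le_trans (hK x) _; rewrite ger_pMr.
Qed.

Lemma dotp_le_dual s x : dotp s x <= dual_norm nrm s * nrm x.
Proof.
have [x0|x0] := eqVneq (nrm x) 0.
  by rewrite x0 mulr0 (nrm_eq0 x0) -(scale0r 0) dotpZr mul0r.
have xp : 0 < nrm x by rewrite lt_neqAle nrm_ge0 eq_sym x0.
rewrite -ler_pdivrMr// mulrC -dotpZr.
apply: sup_upper_bound; first exact: dual_ball_has_sup.
by exists ((nrm x)^-1 *: x) => //=; rewrite nrmZ ger0_norm ?invr_ge0 ?nrm_ge0// mulVf.
Qed.

Lemma coord_le_dual s i : `|s 0 i| <= dual_norm nrm s * nrm (delta_mx 0 i).
Proof.
rewrite ler_norml; have := dotp_le_dual s (delta_mx 0 i).
have := dotp_le_dual s (- delta_mx 0 i).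
by rewrite nrmN dotpNr !dotp_delta; lra.
Qed.

Lemma nrm_sqr_add x y : nrm (x + y) ^+ 2 <= 2 * nrm x ^+ 2 + 2 * nrm y ^+ 2.
Proof.
apply: (@le_trans _ _ ((nrm x + nrm y) ^+ 2)).
  by rewrite ler_sqr ?nnegrE ?addr_ge0 ?nrm_ge0// nrm_le_add.
have := sqr_ge0 (nrm x - nrm y); lra.
Qed.

Lemma nrm_sqr_conv a x y : 0 <= a <= 1 ->
  nrm ((1 - a) *: x + a *: y) ^+ 2 <= (1 - a) * nrm x ^+ 2 + a * nrm y ^+ 2.
Proof.
move=> /andP[a0 a1].
have ha : 0 <= 1 - a by lra.
apply: (@le_trans _ _ (((1 - a) * nrm x + a * nrm y) ^+ 2)).
  rewrite ler_sqr ?nnegrE ?addr_ge0 ?nrm_ge0 ?mulr_ge0 ?nrm_ge0//.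
  by apply: le_trans (nrm_le_add _ _) _; rewrite !nrmZ !ger0_norm.
have := mulr_ge0 (mulr_ge0 ha a0) (sqr_ge0 (nrm x - nrm y)); lra.
Qed.

End Norm.

(** * Smooth and convex functions along segments *)

Section Segments.
Context {R : realType} {n : nat} (X : set 'rV[R]_n).
Hypothesis convX : convex_set (M := 'rV[R]_n) X.
Implicit Types (x y z s : 'rV[R]_n) (a t : R) (F chi : 'rV[R]_n -> R).

Definition seg x z t := (1 - t) *: x + t *: z.

Lemma convex_setP x z t : X x -> X z -> 0 <= t <= 1 -> X (seg x z t).
Proof.
move=> Xx Xz /andP[t0 t1].
have := convX (Itv01 t0 t1) (mem_set Xz) (mem_set Xx).
by rewrite inE /seg addrC.
Qed.

Lemma convex_functionP F x z t : convex_function (E := 'rV[R]_n) X F ->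
  X x -> X z -> 0 <= t <= 1 -> F (seg x z t) <= (1 - t) * F x + t * F z.
Proof.
move=> cF Xx Xz /andP[t0 t1].
have := cF (Itv01 t0 t1) z x (mem_set Xz) (mem_set Xx).
by rewrite /seg addrC [X in _ -> _ <= X]addrC.
Qed.

Lemma seg_diff x z a t : seg x z t - seg x z a = (t - a) *: (z - x).
Proof.
rewrite /seg !scalerBl !scale1r scalerBr !scalerBr.
by apply/rowP => i; rewrite !mxE; ring.
Qed.

(** Restricted to a segment, the relative gradient is a one-variable derivative, one-sided at the
    endpoints. Dividing [e] by the length plus 1 covers the case [z = x]. *)
Lemma gradient_seg F G x z a (e : R) : is_gradient X F G ->
  X x -> X z -> 0 <= a <= 1 -> 0 < e ->
  exists2 d : R, 0 < d & forall t, 0 <= t <= 1 -> `|t - a| < d ->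
    `|F (seg x z t) - F (seg x z a) - (t - a) * dotp (G (seg x z a)) (z - x)|
      <= e * `|t - a|.
Proof.
move=> gF Xx Xz a01 e0.
pose w : R := `|z - x| + 1.
have w0 : 0 < w by rewrite /w ltr_wpDl.
have /gF/(_ (e / w) (divr_gt0 e0 w0)) := convex_setP Xx Xz a01.
rewrite near_withinE => /nbhs_ballP[d /= d0 hd].
exists (d / w) => [|t t01 tad]; first exact: divr_gt0.
have := hd (seg x z t); rewrite -ball_normE /= -opprB normrN seg_diff normrZ.
have tw : `|t - a| * `|z - x| <= `|t - a| * w by rewrite ler_wpM2l// /w lerDl.
move=> /(_ _ (convex_setP Xx Xz t01)); rewrite dotpZr => h.
apply: le_trans (h _) _; last first.
  by rewrite mulrAC ler_pdivrMr// -mulrA ler_wpM2l// ltW.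
by apply: le_lt_trans tw _; rewrite -ltr_pdivlMr.
Qed.

Lemma convex_gradient_le F G x z : convex_function (E := 'rV[R]_n) X F ->
  is_gradient X F G -> X x -> X z -> F x + dotp (G x) (z - x) <= F z.
Proof.
move=> cF gF Xx Xz; apply/ler_addgt0Pr => e e0.
have a01 : 0 <= (0 : R) <= 1 by rewrite lexx ler01.
have [d d0] := gradient_seg gF Xx Xz a01 e0.
pose t := Num.min 1 (d / 2).
have t0 : 0 < t by rewrite lt_min ltr01 divr_gt0.
have t01 : 0 <= t <= 1 by rewrite ltW//= ge_min lexx.
have td : t < d by rewrite gt_min; apply/orP; right; lra.
have s0 : seg x z 0 = x by rewrite /seg subr0 scale1r scale0r addr0.
move=> /(_ t t01); rewrite !subr0 s0 gtr0_norm// => /(_ td).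
rewrite ler_norml => /andP[h1 _].
have h2 := convex_functionP cF Xx Xz t01.
rewrite -(ler_pM2l t0); lra.
Qed.

(** Mean value theorem for [phi], the restriction of [F] to the segment minus the quadratic [q];
    [mono] makes its derivative nonnegative. As [c] may be negative, the same statement gives strong
    convexity of [om] and, applied to [- F], the descent lemma. *)
Lemma gradient_monotone_le F G (N c : R) x z : is_gradient X F G ->
  X x -> X z ->
  (forall t, 0 < t < 1 ->
     c * t * N <= dotp (G (seg x z t) - G x) (z - x)) ->
  F x + dotp (G x) (z - x) + c / 2 * N <= F z.
Proof.
move=> gF Xx Xz mono.
pose q t := t * dotp (G x) (z - x) + c / 2 * N * t ^+ 2.
pose phi t := F (seg x z t) - q t.
pose dphi t := dotp (G (seg x z t)) (z - x) - dotp (G x) (z - x) - c * N * t.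
have phiP a (e : R) : 0 <= a <= 1 -> 0 < e ->
    exists2 d : R, 0 < d & forall t, 0 <= t <= 1 -> `|t - a| < d ->
      `|phi t - phi a - (t - a) * dphi a| <= e * `|t - a|.
  move=> a01 e0.
  have e20 : 0 < e / 2 by lra.
  have [d d0 hd] := gradient_seg gF Xx Xz a01 e20.
  pose w : R := `|c / 2 * N| + 1.
  have w0 : 0 < w by rewrite /w ltr_wpDl.
  exists (Num.min d (e / 2 / w)); first by rewrite lt_min d0 divr_gt0.
  move=> t t01; rewrite lt_min => /andP[td te].
  have {}hd := hd t t01 td.
  have -> : phi t - phi a - (t - a) * dphi a =
      (F (seg x z t) - F (seg x z a) - (t - a) * dotp (G (seg x z a)) (z - x))
      - (c / 2 * N) * (t - a) ^+ 2.
    by rewrite /phi /dphi /q; field.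
  apply: (le_trans (ler_normB _ _)).
  have h2 : `|c / 2 * N * (t - a) ^+ 2| <= e / 2 * `|t - a|.
    rewrite normrM normrX expr2 mulrA ler_wpM2r//.
    apply: (@le_trans _ _ (w * `|t - a|)); first by rewrite ler_wpM2r// /w lerDl.
    by rewrite mulrC -ler_pdivlMr// ltW.
  lra.
have dphiP t : t \in `]0, 1[ -> is_derive t 1 phi (dphi t).
  rewrite in_itv/= => /andP[t0 t1].
  have t01 : 0 <= t <= 1 by rewrite !ltW.
  have cv : h^-1 *: ((phi \o shift t) (h *: 1) - phi t) @[h --> 0^'] --> dphi t.
    apply/cvgrPdist_le => /= e e0.
    have [d d0 hd] := phiP t e t01 e0.
    near=> h.
    have h0 : h != 0 by near: h; exact: nbhs_dnbhs_neq.
    have hs : `|h| < Num.min d (Num.min t (1 - t)).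
      near: h; apply/dnbhs0_lt; rewrite !lt_min d0 t0; lra.
    move: hs; rewrite !lt_min => /and3P[hsd hst hs1].
    rewrite /GRing.scale /= mulr1.
    have := hd (h + t); rewrite addrK hsd => /(_ _ isT) hh.
    have {}hh : `|phi (h + t) - phi t - h * dphi t| <= e * `|h|.
      apply: hh; move: hst hs1; rewrite !ltr_norml => /andP[? ?] /andP[? ?].
      by apply/andP; split; lra.
    rewrite -normrN opprB.
    have -> : h^-1 * (phi (h + t) - phi t) - dphi t
              = h^-1 * (phi (h + t) - phi t - h * dphi t) by field.
    by rewrite normrM normfV mulrC ler_pdivrMr ?normr_gt0.
  apply: DeriveDef; first by apply/cvg_ex; exists (dphi t).
  exact: cvg_lim cv.
(* At the endpoints the gradient is only one-sided, so continuity within [0, 1] takes the place of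
   differentiability there. *)
have cphi : {within `[0, 1], continuous phi}.
  apply/subspace_continuousP => a /=; rewrite in_itv/= => a01.
  apply/cvgrPdist_le => /= e e0.
  have [d d0 hd] := phiP a 1 a01 ltr01.
  pose w : R := 1 + `|dphi a|.
  have w0 : 0 < w by rewrite /w ltr_wpDr.
  rewrite near_withinE; apply/nbhs_ballP.
  exists (Num.min d (e / w)) => /=; first by rewrite lt_min d0 divr_gt0.
  move=> t; rewrite /ball /= lt_min distrC => /andP[td te].
  rewrite in_itv/= => t01.
  have {}hd := hd t t01 td.
  rewrite distrC.
  have -> : phi t - phi a = (phi t - phi a - (t - a) * dphi a) + (t - a) * dphi a by ring.
  apply: (le_trans (ler_normD _ _)); rewrite normrM.
  apply: (@le_trans _ _ (`|t - a| * w)); first by rewrite /w; lra.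
  by rewrite -ler_pdivlMr// ltW.
have [b] := MVT ltr01 dphiP cphi.
rewrite in_itv/= => b01; rewrite subr0 mulr1 /phi /q /dphi.
rewrite {1}/seg {1}/seg subrr subr0 !scale0r !scale1r add0r addr0.
have := mono b b01; rewrite dotpBl; lra.
Unshelve. all: by end_near. Qed.

End Segments.

(** * Bregman distances, the descent lemma and the prox step *)

Section Bregman.
Context {R : realType} {n : nat} (X : set 'rV[R]_n) (nrm : 'rV[R]_n -> R).
Hypotheses (convX : convex_set (M := 'rV[R]_n) X) (nrmP : is_norm nrm).
Implicit Types (x y z s : 'rV[R]_n) (a t : R) (F chi : 'rV[R]_n -> R).

Lemma seg_sub_l x z t : seg x z t - x = t *: (z - x).
Proof. by apply/rowP => i; rewrite /seg !mxE; ring. Qed.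

Lemma bregman_ge nu om gom x z : is_dgf nrm X nu om gom -> X x -> X z ->
  nu / 2 * nrm (x - z) ^+ 2 <= bregman om gom x z.
Proof.
case=> nu0 [gO _] mono Xx Xz.
have := @gradient_monotone_le R n X convX om gom (nrm (z - x) ^+ 2) nu x z gO Xx Xz.
rewrite /bregman (nrm_sub nrmP x) => h.
suff /h : forall t, 0 < t < 1 ->
  nu * t * nrm (z - x) ^+ 2 <= dotp (gom (seg x z t) - gom x) (z - x) by lra.
move=> t /andP[t0 t1].
have t01 : 0 <= t <= 1 by rewrite !ltW.
have := mono _ _ (convex_setP convX Xx Xz t01) Xx.
rewrite seg_sub_l (nrmZ nrmP) gtr0_norm// exprMn dotpZl dotpC => h2.
rewrite -(ler_pM2l t0); lra.
Qed.

Lemma bregman_ge0 nu om gom x z : is_dgf nrm X nu om gom -> X x -> X z ->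
  0 <= bregman om gom x z.
Proof.
move=> d Xx Xz; apply: le_trans (bregman_ge d Xx Xz).
by case: d => nu0 _ _; rewrite mulr_ge0 ?divr_ge0 ?sqr_ge0 ?ltW.
Qed.

Lemma smooth_descent (M : R) F G x z : is_gradient X F G -> X x -> X z ->
  (forall y y', X y -> X y' -> dual_norm nrm (G y - G y') <= M * nrm (y - y')) ->
  F z <= F x + dotp (G x) (z - x) + M / 2 * nrm (z - x) ^+ 2.
Proof.
move=> gF Xx Xz lip.
(* A Lipschitz gradient satisfies the monotonicity hypothesis for [- F] with the negative constant
   [- M]. *)
pose F' y := - F y; pose G' y := - G y.
have gF' : is_gradient X F' G'.
  move=> y Xy e e0; have := gF y Xy e e0; apply: filterS => y'.
  rewrite /F' /G' dotpNl.
  have -> : - F y' - - F y - - dotp (G y) (y' - y)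
            = - (F y' - F y - dotp (G y) (y' - y)) by ring.
  by rewrite normrN.
have := @gradient_monotone_le R n X convX F' G' (nrm (z - x) ^+ 2) (- M) x z gF' Xx Xz.
rewrite /F' /G' dotpNl => h.
suff /h : forall t, 0 < t < 1 ->
  - M * t * nrm (z - x) ^+ 2 <= dotp (- G (seg x z t) - - G x) (z - x) by lra.
move=> t /andP[t0 t1].
have t01 : 0 <= t <= 1 by rewrite !ltW.
have h1 := lip _ _ (convex_setP convX Xx Xz t01) Xx.
have h2 := dotp_le_dual nrmP (G (seg x z t) - G x) (z - x).
rewrite -opprD dotpNl mulNr mulNr lerN2; apply: le_trans h2 _.
rewrite seg_sub_l (nrmZ nrmP) gtr0_norm// in h1.
by rewrite expr2 mulrA ler_wpM2r ?(nrm_ge0 nrmP)// -mulrA.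
Qed.

(* First-order optimality turns the prox step into a subgradient of chi at the
   minimizer, so that the strong convexity of chi applies. *)
Lemma prox_step_ineq (nu mu : R) om gom chi s a0 y0 (b c : R) x y u v :
  is_dgf nrm X nu om gom ->
  (forall x z, X x -> X z -> bregman om gom x z <= 2^-1 * nrm (x - z) ^+ 2) ->
  convex_function (E := 'rV[R]_n) X chi -> 0 <= mu ->
  strongly_convex nrm X mu chi ->
  is_argmin X (fun v => affine_model a0 s y0 v + chi v
     + b * bregman om gom x v + c * bregman om gom y v) u ->
  X v ->
  dotp s u + chi u + b * bregman om gom x u + c * bregman om gom y u
    + (mu + b + c) * bregman om gom u v
  <= dotp s v + chi v + b * bregman om gom x v + c * bregman om gom y v.
Proof.
move=> [nu0 [gO _] _] Vle cchi mu0 schi [Xu umin] Xv.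
pose g := - (s + b *: (gom u - gom x) + c *: (gom u - gom y)).
have gE z : dotp g (z - u) = - (dotp s (z - u)
    + b * (dotp (gom u) (z - u) - dotp (gom x) (z - u))
    + c * (dotp (gom u) (z - u) - dotp (gom y) (z - u))).
  by rewrite /g dotpNl !dotpDl !dotpZl !dotpBl.
have sub : subdiff X chi u g.
  move=> z Xz; apply/ler_addgt0Pr => e e0.
  pose w : R := `|b| + `|c| + 1.
  have w0 : 0 < w by rewrite /w ltr_wpDl ?addr_ge0.
  have a01 : 0 <= (0 : R) <= 1 by rewrite lexx ler01.
  have [d d0] := gradient_seg convX gO Xu Xz a01 (divr_gt0 e0 w0).
  pose t := Num.min 1 (d / 2).
  have t0 : 0 < t by rewrite lt_min ltr01 divr_gt0.
  have t01 : 0 <= t <= 1 by rewrite ltW//= ge_min lexx.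
  have td : t < d by rewrite gt_min; apply/orP; right; lra.
  have s0 : seg u z 0 = u by rewrite /seg subr0 scale1r scale0r addr0.
  move=> /(_ t t01); rewrite !subr0 s0 gtr0_norm// => /(_ td) h1.
  have h2 := convex_functionP cchi Xu Xz t01.
  have Xt := convex_setP convX Xu Xz t01.
  have := umin _ Xt.
  have st : seg u z t = u + t *: (z - u) by rewrite -seg_sub_l addrC subrK.
  rewrite /affine_model /bregman gE.
  have -> : seg u z t - y0 = (u - y0) + t *: (z - u) by rewrite st addrAC.
  have -> : seg u z t - x = (u - x) + t *: (z - u) by rewrite st addrAC.
  have -> : seg u z t - y = (u - y) + t *: (z - u) by rewrite st addrAC.
  rewrite !dotpDr !dotpZr => h3.
  (* [D] is the first-order remainder of [om] along the segment. It enters once with weight [b] and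
     once with weight [c], hence the divisor [w] chosen above. *)
  set D := om (seg u z t) - om u - t * dotp (gom u) (z - u) in h1.
  have hD r : r * D <= `|r| * (e / w * t).
    by apply: le_trans (ler_norm _) _; rewrite normrM ler_wpM2l.
  have hb := hD b; have hc := hD c.
  have hw : (`|b| + `|c|) * (e / w * t) <= e * t.
    have -> : e * t = w * (e / w * t) by field; rewrite gt_eqF.
    apply: ler_wpM2r; last by rewrite /w lerDl.
    by apply: mulr_ge0; [apply: divr_ge0; exact: ltW|exact: ltW].
  rewrite -(ler_pM2l t0).
  rewrite /D in hb hc; rewrite !dotpDr in h3 hb hc *; clear -h2 h3 hb hc hw; lra.
have := schi u v g Xu Xv sub.
have := ler_wpM2l mu0 (Vle u v Xu Xv); rewrite (nrm_sub nrmP u v) gE /bregman.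
(* Splitting at [u] produces the three-point identity for both Bregman terms. *)
have -> : v - x = (v - u) + (u - x) by rewrite addrA subrK.
have -> : v - y = (v - u) + (u - y) by rewrite addrA subrK.
rewrite !(dotpDr, dotpNr).
lra.
Qed.

End Bregman.

(** * One outer iteration *)

Section WeightedSum.
Context {R : realType}.
Implicit Types (a : R) (F G : nat -> R).

(** Exponential average started from 0: [F s] has weight a (1 - a)^(t - s). The total mass 1 - (1 -
    a)^t is 1/2 when [a = alpha k] and [t = T k]. *)
Fixpoint wsum a F t : R :=
  if t is t'.+1 then (1 - a) * wsum a F t' + a * F t else 0.

Lemma wsum_cst a b t : wsum a (fun=> b) t = (1 - (1 - a) ^+ t) * b.
Proof.
elim: t => [|t IH]; first by rewrite expr0 subrr mul0r.
by rewrite exprS /= IH; ring.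
Qed.

Lemma wsum_le a F G t : 0 <= a <= 1 ->
  (forall s, (1 <= s <= t)%N -> F s <= G s) -> wsum a F t <= wsum a G t.
Proof.
move=> /andP[a0 a1]; elim: t => [//|t IH] FG /=.
have ha : 0 <= 1 - a by lra.
apply: lerD; apply: ler_wpM2l => //; last by apply: FG; rewrite leqnn.
by apply: IH => s /andP[s1 st]; apply: FG; rewrite s1 leqW.
Qed.

Lemma wsumZ a c F t : wsum a (fun s => c * F s) t = c * wsum a F t.
Proof. by elim: t => [|t /= ->]; rewrite ?mulr0//; ring. Qed.

Lemma wsum_ge0 a F t : 0 <= a <= 1 -> (forall s, (1 <= s <= t)%N -> 0 <= F s) ->
  0 <= wsum a F t.
Proof. by move=> a01 /(wsum_le a01); rewrite wsum_cst mulr0. Qed.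

End WeightedSum.

(** * Deterministic analysis of a single inner loop *)

Section InnerLoop.
Context {R : realType} {n : nat} (X : set 'rV[R]_n) (nrm : 'rV[R]_n -> R).
Variables (f hk chi om : 'rV[R]_n -> R) (gf gh gom : 'rV[R]_n -> 'rV[R]_n).
Variables (nu mu L M Lh lambda gamma beta a p : R) (T : nat).
Variables (xm xb xu : 'rV[R]_n) (u ut uu Hv : nat -> 'rV[R]_n).
Hypotheses (nrmP : is_norm nrm) (convX : convex_set (M := 'rV[R]_n) X)
  (omP : is_dgf nrm X nu om gom)
  (Vle : forall x z, X x -> X z -> bregman om gom x z <= 2^-1 * nrm (x - z) ^+ 2)
  (cchi : convex_function (E := 'rV[R]_n) X chi)
  (mu0 : 0 < mu) (schi : strongly_convex nrm X mu chi)
  (chk : convex_function (E := 'rV[R]_n) X hk) (ghk : is_gradient X hk gh)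
  (liph : forall y y', X y -> X y' -> dual_norm nrm (gh y - gh y') <= M * nrm (y - y'))
  (cf : convex_function (E := 'rV[R]_n) X f) (gfP : is_gradient X f gf)
  (smf : forall x y, X x -> X y ->
    f x <= f y + dotp (gf y) (x - y) + L / 2 * nrm (x - y) ^+ 2).
Hypotheses (Lh0 : 0 < Lh) (L0 : 0 < L) (LLh : L <= Lh) (lambda01 : 0 < lambda <= 2^-1)
  (gammaE : gamma = lambda / 2) (betaE : beta * nu = Lh * gamma) (beta0 : 0 <= beta)
  (a0 : 0 < a) (a14 : a <= 4^-1) (Ma : M * a ^+ 2 <= Lh / 16) (pE : p * a = 1 - a).
Hypotheses (Xxm : X xm) (Xxb : X xb)
  (xuE : xu = (1 - gamma) *: xb + gamma *: xm)
  (u0 : u 0%N = xm) (ut0 : ut 0%N = xb)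
  (uuE : forall t, (1 <= t <= T)%N ->
    uu t = (1 - lambda) *: xb + (lambda * (1 - a)) *: ut t.-1 + (lambda * a) *: u t.-1)
  (umin : forall t, (1 <= t <= T)%N ->
    is_argmin X (fun v => affine_model (f xu) (gf xu) xu v
        + affine_model (hk (uu t)) (Hv t) (uu t) v + chi v
        + beta * bregman om gom xm v
        + (beta * p + p * mu) * bregman om gom (u t.-1) v) (u t))
  (utE : forall t, (1 <= t <= T)%N -> ut t = (1 - a) *: ut t.-1 + a *: u t).

Let V := bregman om gom.
Let dn := dual_norm nrm.
Let a01 : 0 <= a <= 1.
Proof. by move: a0 a14; lra. Qed.
Let l0 : 0 < lambda. Proof. by case/andP: lambda01. Qed.
Let l12 : lambda <= 2^-1. Proof. by case/andP: lambda01. Qed.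
Let l01 : 0 <= lambda <= 1.
Proof. by move: l0 l12; lra. Qed.
Let nu0 : 0 < nu. Proof. by case: omP. Qed.

(** The next [xbar], were the inner loop stopped after [t] steps. *)
Definition inner_point t := (1 - lambda) *: xb + lambda *: ut t.
Local Notation xt := inner_point.

Lemma inner_in t : (t <= T)%N -> X (u t) /\ X (ut t).
Proof.
elim: t => [|t IH] tT; first by rewrite u0 ut0.
have [Xu Xut] := IH (ltnW tT).
have tT' : (1 <= t.+1 <= T)%N by [].
have [Xu' _] := umin tT'; split => //.
by rewrite utE//; exact: (convex_setP convX).
Qed.

Lemma inner_point_in t : (t <= T)%N -> X (xt t).
Proof. by move=> tT; apply: (convex_setP convX) => //; case: (inner_in tT). Qed.

Let xu_in : X xu.
Proof.
rewrite xuE; apply: (convex_setP convX) => //.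
by rewrite gammaE; move: l0 l12; lra.
Qed.

Let uu_in t : (1 <= t <= T)%N -> X (uu t).
Proof.
move=> h; rewrite uuE//.
have [Xu Xut] : X (u t.-1) /\ X (ut t.-1).
  by apply: inner_in; case/andP: h => _ /(leq_trans (leq_pred _)).
have := convex_setP convX Xxb (convex_setP convX Xut Xu a01) l01.
by rewrite /seg scalerDr !scalerA addrA.
Qed.

(** Only [f] is linearized, at the fixed point [xu], so the model is the same at every inner step;
    [hk] stays exact because its linearization point [uu t] moves. *)
Definition lin_model v := f xu + dotp (gf xu) (v - xu) + hk v + chi v.
Local Notation m := lin_model.

(** The error is tested against [v - u t.-1] rather than [v - u t], because [u t.-1] is fixed before
    the sample is drawn and this product can average to zero. The constant 8 / 5 comes from
    [young]. *)
Definition step_noise v t : R :=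
  lambda * dotp (Hv t - gh (uu t)) (v - u t.-1)
  + 8 / 5 * a / Lh * dn (Hv t - gh (uu t)) ^+ 2.

Definition potential v t : R :=
  m (xt t) - (1 - lambda) * m xb - lambda * m v
  + lambda * (beta + mu) * V (u t) v.

Let xtE t : (1 <= t <= T)%N ->
  xt t = (1 - a) *: xt t.-1 + a *: ((1 - lambda) *: xb + lambda *: u t).
Proof.
move=> h; rewrite /inner_point utE//.
by apply/rowP => i; rewrite !mxE; ring.
Qed.

Let xt_uu t : (1 <= t <= T)%N -> xt t - uu t = (lambda * a) *: (u t - u t.-1).
Proof.
move=> h; rewrite /inner_point utE// uuE//.
by apply/rowP => i; rewrite !mxE; ring.
Qed.

Let chi_xt t : (1 <= t <= T)%N ->
  chi (xt t) <= (1 - a) * chi (xt t.-1) + a * ((1 - lambda) * chi xb + lambda * chi (u t)).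
Proof.
move=> h; have /andP[t1 tT] := h.
have [Xu _] := inner_in tT.
have Xp : X (xt t.-1) by apply: inner_point_in; exact: leq_trans (leq_pred _) tT.
rewrite xtE//.
have h1 := convex_functionP cchi Xp (convex_setP convX Xxb Xu l01) a01.
have h2 := convex_functionP cchi Xxb Xu l01.
by apply: le_trans h1 _; rewrite lerD2l; apply: ler_wpM2l h2; exact: ltW.
Qed.

(** [uu t] is placed so that [xt t - uu t] is [lambda * a] times the prox displacement; the
    quadratic term of the descent lemma can then be paid by V(u_{t-1}, u_t). In the linear term,
    convexity restores [hk] at [xt t.-1] and [xb], and only [u t] remains linearized. *)
Let hk_xt t : (1 <= t <= T)%N ->
  hk (xt t) <= (1 - a) * hk (xt t.-1) + a * (1 - lambda) * hk xb
    + a * lambda * (hk (uu t) + dotp (gh (uu t)) (u t - uu t))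
    + M / 2 * (lambda * a) ^+ 2 * nrm (u t - u t.-1) ^+ 2.
Proof.
move=> h; have /andP[t1 tT] := h.
have [Xu _] := inner_in tT.
have Xp : X (xt t.-1) by apply: inner_point_in; exact: leq_trans (leq_pred _) tT.
have Xxt := inner_point_in tT.
have Xuu := uu_in h.
have h1 := smooth_descent convX nrmP ghk Xuu Xxt liph.
have h2 := convex_gradient_le convX chk ghk Xuu Xp.
have h3 := convex_gradient_le convX chk ghk Xuu Xxb.
rewrite {2}xt_uu// (nrmZ nrmP) ger0_norm ?exprMn in h1; last first.
  by apply: mulr_ge0; exact: ltW.
have a1 : 0 <= 1 - a by move: a01; lra.
have l1 : 0 <= a * (1 - lambda) by apply: mulr_ge0; move: a0 l01; lra.
have {}h2 := ler_wpM2l a1 h2.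
have {}h3 := ler_wpM2l l1 h3.
have E : dotp (gh (uu t)) (xt t) = (1 - a) * dotp (gh (uu t)) (xt t.-1)
   + a * ((1 - lambda) * dotp (gh (uu t)) xb + lambda * dotp (gh (uu t)) (u t)).
  by rewrite {1}xtE// !dotpE.
rewrite !dotpBr E in h1; rewrite !dotpBr in h2 h3 *; rewrite exprMn.
lra.
Qed.

Let prox t v : (1 <= t <= T)%N -> X v ->
  dotp (gf xu) (u t) + dotp (Hv t) (u t) + chi (u t) + beta * V xm (u t)
    + p * (beta + mu) * V (u t.-1) (u t)
    + (1 + p) * (beta + mu) * V (u t) v
  <= dotp (gf xu) v + dotp (Hv t) v + chi v + beta * V xm v
    + p * (beta + mu) * V (u t.-1) v.
Proof.
move=> h Xv.
(* The two affine models are merged into a single one based at 0, the shape that [prox_step_ineq]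
   expects. *)
have um : is_argmin X (fun v =>
    affine_model (f xu - dotp (gf xu) xu + hk (uu t) - dotp (Hv t) (uu t))
      (gf xu + Hv t) 0 v + chi v + beta * bregman om gom xm v
    + (beta * p + p * mu) * bregman om gom (u t.-1) v) (u t).
  have := umin h.
  congr (is_argmin X _ (u t)); apply/funext => w.
  by rewrite /affine_model subr0 !dotpE; ring.
have := prox_step_ineq convX nrmP omP Vle cchi (ltW mu0) schi um Xv.
rewrite !dotpDl -/V; lra.
Qed.

(** In units of Lh (lambda d)^2, the prox term is worth at least 6/32, since 1 - a >= 3/4 and beta
    nu = Lh lambda / 2. The curvature takes 1/32, and completing the square on the remaining 5/32
    gives the noise coefficient 8/5 = 32 / (4 x 5). *)
Let young t : (1 <= t <= T)%N ->
  a * lambda * (dn (Hv t - gh (uu t)) * nrm (u t - u t.-1))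
    + M / 2 * (lambda * a) ^+ 2 * nrm (u t - u t.-1) ^+ 2
  <= lambda * (1 - a) * (beta + mu) * (nu / 2 * nrm (u t - u t.-1) ^+ 2)
    + 8 / 5 * a ^+ 2 / Lh * dn (Hv t - gh (uu t)) ^+ 2.
Proof.
move=> h; set D := dn _; set d := nrm _.
have la0 := ltW l0.
have h1 : M / 2 * (lambda * a) ^+ 2 * d ^+ 2 <= Lh / 32 * (lambda * d) ^+ 2.
  have := ler_wpM2r (sqr_ge0 (lambda * d)) Ma; rewrite !exprMn; lra.
have h2 : 3 / 16 * Lh * (lambda * d) ^+ 2
    <= lambda * (1 - a) * (beta + mu) * (nu / 2 * d ^+ 2).
  have b1 : 3 / 4 * beta <= (1 - a) * (beta + mu).
    have /(ler_pM _ beta0) : (3 / 4 : R) <= 1 - a by move: a14; lra.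
    by apply; move: mu0; lra.
  have := ler_wpM2l (mulr_ge0 la0 (mulr_ge0 (ltW nu0) (sqr_ge0 d))) b1.
  have := congr1 (fun z => 3 / 8 * lambda * d ^+ 2 * z) betaE.
  rewrite gammaE exprMn => /= e1 e2; lra.
have h3 : a * lambda * (D * d) - 5 / 32 * Lh * (lambda * d) ^+ 2
    <= 8 / 5 * a ^+ 2 / Lh * D ^+ 2.
  have Lhn : Lh != 0 by rewrite gt_eqF.
  rewrite -subr_ge0.
  have -> : 8 / 5 * a ^+ 2 / Lh * D ^+ 2
     - (a * lambda * (D * d) - 5 / 32 * Lh * (lambda * d) ^+ 2)
     = 5 / 32 * Lh * (lambda * d - 16 / 5 * a * D / Lh) ^+ 2 by field.
  by rewrite mulr_ge0 ?sqr_ge0// mulr_ge0 ?ltW//.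
lra.
Qed.

Lemma potential_step t v : (1 <= t <= T)%N -> X v ->
  potential v t + lambda * beta * (a * V xm (u t))
  <= (1 - a) * potential v t.-1 + a * (lambda * beta * V xm v)
     + a * step_noise v t.
Proof.
move=> h Xv; have /andP[t1 tT] := h.
have [Xu _] := inner_in tT.
have tT' : (t.-1 <= T)%N by exact: leq_trans (leq_pred _) tT.
have [Xp _] := inner_in tT'.
have al0 : 0 <= a * lambda by apply: mulr_ge0; exact: ltW.
have h1 := hk_xt h; have h2 := chi_xt h.
have h3 := ler_wpM2l al0 (prox h Xv).
have h4 := ler_wpM2l al0 (convex_gradient_le convX chk ghk (uu_in h) Xv).
have h5 := young h.
have c0 : 0 <= lambda * (1 - a) * (beta + mu).
  by apply: mulr_ge0; [apply: mulr_ge0; move: l01 a01; lra|apply: addr_ge0 => //; exact: ltW].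
have h6 := ler_wpM2l c0 (bregman_ge convX nrmP omP Xp Xu).
rewrite (nrm_sub nrmP) in h6.
(* The part of the error tested against u_{t-1} - u_t depends on the sample itself; it is bounded by
   duality and absorbed by [young]. *)
have h7 := ler_wpM2l al0 (dotp_le_dual nrmP (Hv t - gh (uu t)) (u t.-1 - u t)).
rewrite (nrm_sub nrmP (u t.-1)) in h7.
have E : dotp (gf xu) (xt t) = (1 - a) * dotp (gf xu) (xt t.-1)
   + a * ((1 - lambda) * dotp (gf xu) xb + lambda * dotp (gf xu) (u t)).
  by rewrite {1}xtE// !dotpE.
rewrite -/(V _ _) in h6.
(* Since q = p mu, both prox coefficients are multiples of beta + mu. After multiplication by [a],
   the relation p a = 1 - a turns them into the weights 1 - a and 1 that the potentials carry. *)
have e1 z : a * lambda * (p * (beta + mu) * z) = lambda * (1 - a) * (beta + mu) * z.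
  by rewrite -pE; ring.
have e2 z : a * lambda * ((1 + p) * (beta + mu) * z) = lambda * (beta + mu) * z.
  have -> : a * lambda * ((1 + p) * (beta + mu) * z)
      = (a + p * a) * lambda * (beta + mu) * z by ring.
  by rewrite pE; ring.
rewrite /potential /step_noise /lin_model.
have {}e1 := (e1 (V (u t.-1) (u t)), e1 (V (u t.-1) v)).
have {}e2 := e2 (V (u t) v).
case: e1 => e1 e3.
rewrite -/dn in h7.
move: h1 h2 E; move: (xt t) (xt t.-1) => y y' h1 h2 E.
rewrite !dotpE in h1 h4 h7 *; rewrite E.
move: h1 h2 h3 h4 h5 h6 h7 e1 e2 e3.
move: (dn _) (nrm _) (V xm _) (V _ _) (V _ _) (V _ _) => D d V1 V2 V3 V4.
lra.
Qed.

Let ca0 : 0 <= 1 - a. Proof. by move: a01; lra. Qed.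

Lemma potential_sum t v : (t <= T)%N -> X v ->
  potential v t + lambda * beta * wsum a (fun s => V xm (u s)) t
  <= (1 - a) ^+ t * potential v 0 + lambda * beta * (1 - (1 - a) ^+ t) * V xm v
     + wsum a (step_noise v) t.
Proof.
move=> + Xv; elim: t => [|t IH] tT; first by rewrite /= expr0; lra.
have tT' : (1 <= t.+1 <= T)%N by [].
have h1 := potential_step tT' Xv.
have h2 := ler_wpM2l ca0 (IH (ltnW tT)).
by rewrite [wsum _ _ _]/= [wsum _ (step_noise v) _]/= exprS; move: h1 h2 => /=; lra.
Qed.

(* [ut t] minus the value it would have if every [u s] were [xm]. *)
Let centered t := ut t - (1 - a) ^+ t *: xb - (1 - (1 - a) ^+ t) *: xm.

Let pow01 t : 0 <= 1 - (1 - a) ^+ t.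
Proof. by rewrite subr_ge0 exprn_ile1//; move: a01; lra. Qed.

(** Jensen's inequality for the squared norm: [centered t] is the sum of the vectors u_s - [xm] with
    the weights of [wsum], of total mass 1 - (1 - a)^t. *)
Lemma centered_le t : (t <= T)%N ->
  nrm (centered t) ^+ 2
  <= (1 - (1 - a) ^+ t) * wsum a (fun s => nrm (u s - xm) ^+ 2) t.
Proof.
elim: t => [|t IH] tT.
  by rewrite /centered expr0 ut0 scale1r !subrr scale0r subr0 (nrm0 nrmP) expr0n/= mulr0.
have tT' : (1 <= t.+1 <= T)%N by [].
have -> : centered t.+1 = (1 - a) *: centered t + a *: (u t.+1 - xm).
  by rewrite /centered utE//= exprS; apply/rowP => i; rewrite !mxE; ring.
have {}IH := IH (ltnW tT); rewrite /= (exprS (1 - a) t).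
have W0 := pow01 t; have S0 : 0 <= wsum a (fun s => nrm (u s - xm) ^+ 2) t.
  by apply: wsum_ge0 => // s _; exact: sqr_ge0.
set S := wsum _ _ _ in IH S0 *; set b := nrm (u t.+1 - xm).
have := nrm_le_add nrmP ((1 - a) *: centered t) (a *: (u t.+1 - xm)).
rewrite !(nrmZ nrmP) !ger0_norm ?(ltW a0)// -/b => h.
have n0 := nrm_ge0 nrmP (centered t); have b0 := nrm_ge0 nrmP (u t.+1 - xm).
set e := nrm (centered t) in IH h n0; rewrite -/b in b0.
set W := 1 - (1 - a) ^+ t in IH W0.
have -> : 1 - (1 - a) * (1 - a) ^+ t = (1 - a) * W + a by rewrite /W; ring.
apply: (@le_trans _ _ (((1 - a) * e + a * b) ^+ 2)).
  by rewrite ler_sqr ?nnegrE ?(nrm_ge0 nrmP) ?addr_ge0 ?mulr_ge0 ?(ltW a0).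
(* Cauchy-Schwarz: [e b <= sqrt (W S) b <= (S + W b^2) / 2] *)
have cs : 2 * (e * b) <= S + W * b ^+ 2.
  rewrite -ler_sqr ?nnegrE ?addr_ge0 ?mulr_ge0 ?sqr_ge0//.
  have h1 := ler_wpM2r (sqr_ge0 b) IH.
  have := sqr_ge0 (S - W * b ^+ 2); move: h1; rewrite !exprMn; lra.
have h1 := ler_wpM2l (mulr_ge0 ca0 (ltW a0)) cs.
have h2 := ler_wpM2l (mulr_ge0 ca0 ca0) IH.
lra.
Qed.

Let wsumV_ge t : (t <= T)%N ->
  nu / 2 * wsum a (fun s => nrm (u s - xm) ^+ 2) t <= wsum a (fun s => V xm (u s)) t.
Proof.
move=> tT; rewrite -wsumZ; apply: wsum_le => // s /andP[_ st].
rewrite (nrm_sub nrmP); apply: (bregman_ge convX nrmP omP) => //.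
by case: (inner_in (leq_trans st tT)).
Qed.

(** Replaces the linearized [f] by [f] itself. With W = 1 - (1 - a)^t, the vector [xt t - xu] has
    component gamma (1 - 2 W) along [xb - xm]; the corresponding term vanishes at the last inner
    step, where W = 1/2, and is harmless before. *)
Lemma inner_bound t v : (t <= T)%N -> X v -> 2 * (1 - (1 - a) ^+ t) <= 1 ->
  f (xt t) + hk (xt t) + chi (xt t) + lambda * (beta + mu) * V (u t) v
  <= (1 - lambda * (1 - (1 - a) ^+ t)) * (f xb + hk xb + chi xb)
     + lambda * (1 - (1 - a) ^+ t) * (f v + hk v + chi v)
     + (lambda * (beta + mu) * (1 - a) ^+ t
        + lambda * beta * (1 - (1 - a) ^+ t)) * V xm v
     + L / 2 * gamma ^+ 2 * (1 - 2 * (1 - (1 - a) ^+ t)) * nrm (xb - xm) ^+ 2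
     + wsum a (step_noise v) t.
Proof.
move=> tT Xv.
have h1 := potential_sum tT Xv.
have h2 := wsumV_ge tT.
have h3 := centered_le tT.
have W0 := pow01 t.
have Xxt := inner_point_in tT.
have h4 := smf Xxt xu_in.
have x00 : xt 0 = xb by rewrite /inner_point ut0 -scalerDl subrK scale1r.
have h5 := convex_gradient_le convX cf gfP xu_in Xxb.
have h6 := convex_gradient_le convX cf gfP xu_in Xv.
have S0 : 0 <= wsum a (fun s => nrm (u s - xm) ^+ 2) t.
  by apply: wsum_ge0 => // s _; exact: sqr_ge0.
set W := 1 - (1 - a) ^+ t in h1 h3 W0 *.
have cE : (1 - a) ^+ t = 1 - W by rewrite /W; ring.
rewrite cE in h1 *; move=> W12.
have hz : nrm (xt t - xu) <= gamma * (2 * nrm (centered t) + (1 - 2 * W) * nrm (xb - xm)).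
  have -> : xt t - xu = gamma *: (2 *: centered t + (1 - 2 * W) *: (xb - xm)).
    have lE : lambda = 2 * gamma by rewrite gammaE; field.
    rewrite /centered -/W cE /inner_point xuE lE.
    by apply/rowP => i; rewrite !mxE; ring.
  have g0 : 0 <= gamma by rewrite gammaE; move: l0; lra.
  rewrite (nrmZ nrmP) ger0_norm//; apply: ler_wpM2l => //.
  apply: le_trans (nrm_le_add nrmP _ _) _; rewrite !(nrmZ nrmP) !ger0_norm//.
  by rewrite subr_ge0.
have z0 := nrm_ge0 nrmP (centered t); have x0 := nrm_ge0 nrmP (xb - xm).
have y0 := nrm_ge0 nrmP (xt t - xu).
have hz2 : nrm (xt t - xu) ^+ 2 <= gamma ^+ 2 *
    (2 * wsum a (fun s => nrm (u s - xm) ^+ 2) t + (1 - 2 * W) * nrm (xb - xm) ^+ 2).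
  apply: (@le_trans _ _
    ((gamma * (2 * nrm (centered t) + (1 - 2 * W) * nrm (xb - xm))) ^+ 2)).
    by rewrite ler_sqr ?nnegrE// (le_trans y0).
  rewrite exprMn; apply: ler_wpM2l; first exact: sqr_ge0.
  set e := nrm (centered t) in h3 z0 *; set d := nrm (xb - xm) in x0 *.
  set S := wsum _ _ _ in h3 S0 *.
  have w1 : 0 <= 1 - 2 * W by rewrite subr_ge0.
  (* Convexity of the square at the points e / W and d, with weights 2 W and 1 - 2 W; the case W =
     0, which forces e = 0, is separate. *)
  have [W00|Wn0] := eqVneq W 0.
    have e0 : e = 0.
      apply/eqP; rewrite -sqrf_eq0 eq_le sqr_ge0 andbT.
      by move: h3; rewrite W00 mul0r.
    by rewrite W00 e0; move: S0; lra.
  have Wp : 0 < W by rewrite lt_neqAle eq_sym Wn0.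
  rewrite -(ler_pM2l Wp).
  have := mulr_ge0 w1 (sqr_ge0 (e - W * d)).
  move: h3; lra.
have L20 : 0 <= L / 2 by move: L0; lra.
have h7 := ler_wpM2l L20 hz2.
have lb0 : 0 <= lambda * beta := mulr_ge0 (ltW l0) beta0.
have h8 := ler_wpM2l lb0 h2.
(* The accumulated terms beta V(x_{k-1}, u_s) supply Lh gamma^2 S, while linearizing [f] costs (L /
   2) gamma^2 times 2 S; L <= Lh closes the account. *)
have bn : lambda * beta * (nu / 2) = Lh * gamma ^+ 2.
  have -> : lambda * beta * (nu / 2) = lambda / 2 * (beta * nu) by field.
  by rewrite betaE -gammaE; ring.
have h9 := ler_wpM2r (mulr_ge0 (sqr_ge0 gamma) S0) LLh.
have h10 : 0 <= 1 - lambda * W.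
  have := mulr_ge0 (ltW l0) W0; move: l01 W12 W0; nra.
have {}h5 := ler_wpM2l h10 h5.
have {}h6 := ler_wpM2l (mulr_ge0 (ltW l0) W0) h6.
rewrite /potential /lin_model x00 u0 in h1.
have {}bn := congr1 ( *%R ^~ (wsum a (fun s => nrm (u s - xm) ^+ 2) t)) bn.
move: h1 h4 h5 h6 h7 h8 h9 bn => /=.
lra.
Qed.

End InnerLoop.

(** * Integrable majorants and sub-sigma-algebras *)

Section Dominated.
Context {d : measure_display} {Omega : measurableType d} {R : realType}.
Variable P : probability Omega R.
Implicit Types (F G : Omega -> R) (a b c : R).

(* F need not be measurable: the bound b is on the integral of a majorant. *)
Definition dominated F b := exists g : Omega -> R,
  [/\ P.-integrable setT (EFin \o g), forall w, F w <= g w &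
      (\int[P]_w (g w)%:E <= b%:E)%E].

Lemma dominated_le F G b c : dominated G b -> b <= c -> (forall w, F w <= G w) ->
  dominated F c.
Proof.
move=> [g [gi Gg gb]] bc FG; exists g; split => // [w|].
  exact: le_trans (FG w) (Gg w).
by apply: le_trans gb _; rewrite lee_fin.
Qed.

Lemma dominated_cst b : dominated (fun=> b) b.
Proof.
exists (fun=> b); split => //; first exact: finite_measure_integrable_cst.
by rewrite integral_cst//= probability_setT mule1.
Qed.

Lemma dominatedD F G b c : dominated F b -> dominated G c ->
  dominated (fun w => F w + G w) (b + c).
Proof.
move=> [g [gi Fg gb]] [g' [gi' Gg gc]]; exists (fun w => g w + g' w); split.
- by apply: (eq_integrable _ ((EFin \o g) \+ (EFin \o g'))%E) => //; exact: integrableD.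
- by move=> w; exact: lerD.
- under eq_integral do rewrite EFinD.
  by rewrite integralD// EFinD leeD.
Qed.

Lemma dominatedZ a F b : 0 <= a -> dominated F b ->
  dominated (fun w => a * F w) (a * b).
Proof.
move=> a0 [g [gi Fg gb]]; exists (fun w => a * g w); split.
- by apply: (eq_integrable _ (fun w => a%:E * (g w)%:E)%E) => //; exact: integrableZl.
- by move=> w; exact: ler_wpM2l.
- under eq_integral do rewrite EFinM.
  by rewrite integralZl// EFinM lee_wpmul2l// lee_fin.
Qed.

Lemma dominated_wsum a (F : nat -> Omega -> R) (b : nat -> R) t : 0 <= a <= 1 ->
  (forall s, (1 <= s <= t)%N -> dominated (F s) (b s)) ->
  dominated (fun w => wsum a (F ^~ w) t) (wsum a b t).
Proof.
move=> /andP[a0 a1]; elim: t => [|t IH] h /=; first exact: dominated_cst.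
apply: dominatedD; apply: dominatedZ; rewrite ?subr_ge0//.
  by apply: IH => s /andP[s1 st]; apply: h; rewrite s1 leqW.
by apply: h; rewrite leqnn.
Qed.

(** The integral of a nonnegative function is a supremum over simple functions below it, hence
    monotone even where [F] is not measurable. *)
Lemma dominated_expectation F b : (forall w, 0 <= F w) -> dominated F b ->
  ('E_P[F] <= b%:E)%E.
Proof.
move=> F0 [g [gi Fg gb]]; rewrite unlock; apply: le_trans gb.
rewrite !ge0_integralTE => [|w|w]; last 2 first.
- by rewrite lee_fin (le_trans (F0 w)).
- by rewrite lee_fin.
apply: le_ereal_sup => _ [h hF <-]; exists h => // w.
by apply: le_trans (hF w) _; rewrite lee_fin.
Qed.

End Dominated.

(** * Pulling a measurable factor out of a conditional expectation equal to zero *)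

Section SubSigmaAlgebra.
Context {d : measure_display} {Omega : measurableType d} {R : realType}.
Variable P : probability Omega R.
Variable G : set (set Omega).
Hypothesis GM : <<s G>> `<=` @measurable d Omega.
Implicit Types (Y Z : Omega -> R).
Let T := g_sigma_algebraType G.

Lemma measurable_fun_sub {d'} {U : measurableType d'} (f : T -> U) :
  measurable_fun (T := T) setT f -> measurable_fun (T := Omega) setT f.
Proof. by move=> mf _ B mB; apply: GM; exact: mf. Qed.

Lemma measurable_wrt_fun Y : measurable_wrt <<s G>> Y ->
  measurable_fun (T := T) setT Y.
Proof.
move=> mY; apply: (measurability _ (RGenOInfty.measurableE R)).
move=> _ [_ [x ->] <-]; rewrite setTI.
apply: mY; rewrite set_itvE; exact: open_gt.
Qed.

(** [h] splits over its level sets; these lie in the sub-sigma-algebra, where [Z] integrates to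
    zero. *)
Lemma integral_mul_simple_eq0 Z (h : {nnsfun T >-> R}) :
  P.-integrable setT (EFin \o Z) ->
  (forall A, <<s G>> A -> (\int[P]_(w in A) (Z w)%:E = 0)%E) ->
  (\int[P]_w (Z w * h w)%:E = 0)%E.
Proof.
move=> iZ Z0.
have hE w : (Z w * h w)%:E = (\sum_(y <- finmap.enum_fset (fset_set (range h)))
     (y%:E * ((EFin \o Z) \_ (h @^-1` [set y])) w))%E.
  rewrite (fimfunE h w) fsbig_finite//= mulr_sumr.
  rewrite -sumEFin; apply: eq_bigr => y _.
  rewrite indicE patchE; have [e|e] := eqVneq (h w) y.
    by rewrite !mem_set// mulr1 -EFinM mulrC.
  by rewrite !memNset ?mulr0 ?mule0//; exact/eqP.
under eq_integral do rewrite hE.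
have mh y : <<s G>> (h @^-1` [set y]).
  exact: (@measurable_funPTI _ _ T R h [set y] (measurable_set1 y)).
have iy y : P.-integrable setT ((EFin \o Z) \_ (h @^-1` [set y])).
  apply: (proj1 (integrable_mkcond (EFin \o Z) (GM (mh y)))).
  exact: (integrableS measurableT (GM (mh y)) _ iZ).
rewrite (@integral_sum _ _ _ P setT measurableT _
  (fun y w => (y%:E * ((EFin \o Z) \_ (h @^-1` [set y])) w)%E)); last first.
  by move=> y; exact: integrableZl.
rewrite big1// => y _; rewrite integralZl// -integral_mkcond Z0 ?mule0//.
Qed.

(** Dominated convergence with majorant |Z Y|, along simple functions increasing to [Y]. They are
    built over the sub-sigma-algebra, so the simple case applies to each of them. *)
Lemma integral_mul_ge0_eq0 Z Y : (forall w, 0 <= Y w) -> measurable_wrt <<s G>> Y ->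
  P.-integrable setT (EFin \o Z) ->
  (forall A, <<s G>> A -> (\int[P]_(w in A) (Z w)%:E = 0)%E) ->
  P.-integrable setT (fun w => (Z w * Y w)%:E) ->
  (\int[P]_w (Z w * Y w)%:E = 0)%E.
Proof.
move=> Y0 /measurable_wrt_fun mY iZ Z0 iZY.
have mfY := proj2 (@measurable_EFinP _ T R setT Y) mY.
pose h i := nnsfun_approx measurableT mfY i.
have hcvg w : (h i w)%:E @[i --> \oo] --> (Y w)%:E.
  by apply: (cvg_nnsfun_approx measurableT mfY) => // w' _; rewrite lee_fin.
have hle i w : 0 <= h i w <= Y w.
  rewrite fun_ge0/= -lee_fin /h nnsfun_approxE.
  by apply: le_approx => // w' _; rewrite lee_fin.
have mZ : measurable_fun setT Z by move/integrableP : iZ => [/measurable_EFinP].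
have := @dominated_convergence _ _ _ P setT measurableT
  (fun i w => (Z w * h i w)%:E) (fun w => (Z w * Y w)%:E) (fun w => `|Z w * Y w|%:E).
case.
- move=> i; apply/measurable_EFinP; apply: measurable_funM => //.
  by apply: measurable_fun_sub; exact: measurable_funP.
- by move/integrableP : iZY => [].
- apply: aeW => w _.
  under eq_fun do rewrite EFinM.
  by rewrite EFinM; apply: cvgeZl => //; exact: hcvg.
- exact: integrable_abse iZY.
- apply: aeW => w i _ /=; rewrite lee_fin !normrM ler_wpM2l//.
  by case/andP: (hle i w) => h0 h1; rewrite !ger0_norm.
move=> _ _; under [X in X @ _ --> _]eq_fun do rewrite integral_mul_simple_eq0//.
by move=> /cvg_lim <- //; rewrite lim_cst.
Qed.

(** Positive and negative parts of [Y] are treated separately; each is at most |Y|, so integrability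
    of Z Y passes to both products. *)
Lemma integral_mul_eq0 Z Y : measurable_wrt <<s G>> Y ->
  P.-integrable setT (EFin \o Z) ->
  (forall A, <<s G>> A -> (\int[P]_(w in A) (Z w)%:E = 0)%E) ->
  P.-integrable setT (fun w => (Z w * Y w)%:E) ->
  (\int[P]_w (Z w * Y w)%:E = 0)%E.
Proof.
move=> mY iZ Z0 iZY.
have mZY : measurable_fun setT (fun w => Z w * Y w).
  by move/integrableP : iZY => [/measurable_EFinP].
have part (s : R -> R) : continuous s -> (forall r, 0 <= s r <= `|r|) ->
    P.-integrable setT (fun w => (Z w * s (Y w))%:E) /\
    (\int[P]_w (Z w * s (Y w))%:E = 0)%E.
  move=> cs s0.
  have ms : measurable_wrt <<s G>> (s \o Y).
    by move=> U oU; rewrite comp_preimage; apply: mY; apply: open_comp => // r _; exact: cs.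
  have iZs : P.-integrable setT (fun w => (Z w * s (Y w))%:E).
    apply: (le_integrable measurableT _ _ iZY) => [|w _].
      apply/measurable_EFinP; apply: measurable_funM.
        by move/integrableP : iZ => [/measurable_EFinP].
      by apply: measurable_fun_sub; exact: measurable_wrt_fun.
    rewrite /= lee_fin !normrM ler_wpM2l//.
    by case/andP: (s0 (Y w)) => h0 h1; rewrite ger0_norm.
  split => //; apply: (integral_mul_ge0_eq0 (Y := s \o Y)) => // w /=.
  by case/andP: (s0 (Y w)).
have absE (r : R) : 0 <= Num.max r 0 <= `|r|.
  by rewrite le_max lexx orbT ge_max ler_norm normr_ge0.
have [i1 e1] : P.-integrable setT (fun w => (Z w * Num.max (Y w) 0)%:E) /\
    (\int[P]_w (Z w * Num.max (Y w) 0)%:E = 0)%E.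
  apply: (part (fun r => Num.max r 0)) => // r.
  by apply: continuous_max; [exact: cvg_id|exact: cvg_cst].
have [i2 e2] : P.-integrable setT (fun w => (Z w * Num.max (- Y w) 0)%:E) /\
    (\int[P]_w (Z w * Num.max (- Y w) 0)%:E = 0)%E.
  apply: (part (fun r => Num.max (- r) 0)) => [r|r].
    by apply: continuous_max; [apply: continuousN; exact: cvg_id|exact: cvg_cst].
  by rewrite -normrN.
transitivity (\int[P]_w ((Z w * Num.max (Y w) 0)%:E - (Z w * Num.max (- Y w) 0)%:E))%E.
  apply: eq_integral => w _; rewrite -EFinB -mulrBr; congr (_ * _)%:E.
  by case: (leP (Y w) 0) => h; case: leP => h'; lra.
by rewrite integralB// e1 e2 sube0.
Qed.

End SubSigmaAlgebra.

(** * The stochastic oracle *)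

Section Oracle.
Context {d : measure_display} {Omega : measurableType d} {R : realType}.
Variable P : probability Omega R.

Lemma dominated_integrable (g : Omega -> R) b : P.-integrable setT (EFin \o g) ->
  (\int[P]_w (g w)%:E <= b%:E)%E -> dominated P g b.
Proof. by move=> gi gb; exists g. Qed.

Lemma dominated_sum0 (I : Type) (s : seq I) (F : I -> Omega -> R) :
  (forall i, dominated P (F i) 0) -> dominated P (fun w => \sum_(i <- s) F i w) 0.
Proof.
move=> h; elim: s => [|i s IH].
  by apply: (dominated_le (dominated_cst P 0)) => // w; rewrite big_nil.
apply: (dominated_le (dominatedD (h i) IH)) => [|w]; first by rewrite addr0.
by rewrite big_cons.
Qed.

Lemma integral_le_ae_cst (Y : Omega -> R) c : P.-integrable setT (EFin \o Y) ->
  {ae P, forall w, Y w <= c} -> (\int[P]_w (Y w)%:E <= c%:E)%E.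
Proof.
move=> iY Yc; have mY : measurable_fun setT Y.
  by move/integrableP : iY => [/measurable_EFinP].
(* The truncation at [c] equals [Y] almost everywhere and satisfies the bound everywhere, as
   pointwise monotonicity of the integral requires. *)
have mm : measurable_fun setT (fun w => Num.min (Y w) c).
  by apply: measurable_minr.
have ic : P.-integrable setT (EFin \o (fun=> c)).
  exact: finite_measure_integrable_cst.
rewrite (_ : (\int[P]_w _ = \int[P]_w (Num.min (Y w) c)%:E)%E).
  apply: (@le_trans _ _ (\int[P]_w (c%:E))%E); last first.
    by rewrite integral_cst//= probability_setT mule1.
  apply: le_integral => //; last by move=> w _; rewrite lee_fin ge_min lexx orbT.
  have := integrableD measurableT (integrable_abse iY) (integrable_abse ic).
  apply: le_integrable => //; first exact/measurable_EFinP.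
  move=> w _ /=; rewrite lee_fin [leRHS]ger0_norm ?addr_ge0//.
  by rewrite /Num.min; case: ifP => _; rewrite ?lerDl ?lerDr normr_ge0.
apply: ae_eq_integral => //; [exact/measurable_EFinP|exact/measurable_EFinP|].
apply: filterS Yc => w h _ /=; congr (_%:E).
by rewrite min_l.
Qed.

Context {d' : measure_display} {Xi : measurableType d'}.
Context {n : nat} (nrm : 'rV[R]_n -> R).
Hypothesis nrmP : is_norm nrm.
Variables (gheta : R -> 'rV[R]_n -> 'rV[R]_n) (H : R -> 'rV[R]_n -> Xi -> 'rV[R]_n)
  (eta : nat -> R) (N : nat) (T : nat -> nat) (xi : nat -> nat -> Omega -> Xi)
  (u uund : nat -> nat -> Omega -> 'rV[R]_n) (sigma : R).
Hypothesis so : stochastic_oracle P nrm gheta H eta N T xi u uund sigma.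

Definition oracle_error k t w :=
  H (eta k) (uund k t w) (xi k t w) - gheta (eta k) (uund k t w).

Lemma history_measurable k t : (1 <= k <= N)%N -> (1 <= t <= T k)%N ->
  history T xi k t `<=` @measurable d Omega.
Proof.
move=> /andP[k1 kN] /andP[t1 tT]; apply: smallest_sub.
  exact: sigma_algebra_measurable.
move=> _ [j [s [B [j1 sT jk mB ->]]]].
have jN : (1 <= j <= N)%N.
  by rewrite j1; case: jk => [/ltnW jk|[-> _]]; rewrite ?kN// (leq_trans jk).
by rewrite -[X in measurable X]setTI; exact: (so_measurable so jN sT).
Qed.

Lemma history_setT k t : history T xi k t setT.
Proof. exact: (@measurableT _ (g_sigma_algebraType _)). Qed.

Lemma oracle_error_sqr k t : (1 <= k <= N)%N -> (1 <= t <= T k)%N ->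
  P.-integrable setT (EFin \o (fun w => dual_norm nrm (oracle_error k t w) ^+ 2)) /\
  (\int[P]_w (dual_norm nrm (oracle_error k t w) ^+ 2)%:E <= (sigma ^+ 2)%:E)%E.
Proof.
move=> hk ht; have [Y [iZ iY _ ZY] Ys] := so_variance so hk ht; split => //.
by rewrite ZY ?integral_le_ae_cst//; exact: history_setT.
Qed.

Lemma oracle_error_mean0 k t i A : (1 <= k <= N)%N -> (1 <= t <= T k)%N ->
  history T xi k t A ->
  P.-integrable setT (EFin \o (fun w => oracle_error k t w 0 i)) /\
  (\int[P]_(w in A) (oracle_error k t w 0 i)%:E = 0)%E.
Proof.
move=> hk ht hA; have [iZ iY _ ZY] := so_unbiased so hk ht i.
have E w : (oracle_error k t w 0 i)%:E
  = ((H (eta k) (uund k t w) (xi k t w) 0 i)%:E - (gheta (eta k) (uund k t w) 0 i)%:E)%E.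
  by rewrite /oracle_error !mxE.
have mA := history_measurable hk ht hA.
split; first by apply: eq_integrable (integrableB measurableT iZ iY) => // w _; rewrite /= E.
under eq_integral do rewrite E.
have iZA := integrableS measurableT mA (@subsetT _ A) iZ.
have iYA := integrableS measurableT mA (@subsetT _ A) iY.
rewrite integralB// ZY// subee//; exact: integrable_fin_num.
Qed.

(** Each coordinate of the error times that of [v - u] is integrable: the product is at most the sum
    of the squares, controlled by the second moment of the error and by the majorant [g]. Its mean
    vanishes because u_{t-1} is measurable for the history. *)
Lemma oracle_error_dotp k t (v : 'rV[R]_n) b : (1 <= k <= N)%N -> (1 <= t <= T k)%N ->
  dominated P (fun w => nrm (u k t.-1 w - v) ^+ 2) b ->
  dominated P (fun w => dotp (oracle_error k t w) (v - u k t.-1 w)) 0.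
Proof.
move=> hk ht [g [gi gle _]].
apply: dominated_sum0 => i.
have [K K0 hK] := norm_le_nrm nrmP.
have [iD _] := oracle_error_sqr hk ht.
have hi := history_measurable hk ht.
have mY : measurable_wrt (history T xi k t) (fun w => (v - u k t.-1 w) 0 i).
  move=> U oU; have [_ mu] := so_adapted so hk ht.
  have cf : continuous (fun y : 'rV[R]_n => (v - y) 0 i).
    rewrite (_ : (fun y => _) = (fun y : 'rV[R]_n => v 0 i - y 0 i)); last first.
      by apply/funext => z; rewrite !mxE.
    move=> y.
    apply: (@cvgB _ _ _ (nbhs y) _ (fun=> v 0 i) (fun y : 'rV[R]_n => y 0 i)).
      exact: cvg_cst.
    exact: coord_continuous.
  exact: mu (proj1 (continuousP _) cf _ oU).
have [iZ _] := oracle_error_mean0 i hk ht (@history_setT k t).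
have mZ : measurable_fun setT (fun w => oracle_error k t w 0 i).
  by move/integrableP : iZ => [/measurable_EFinP].
pose c := nrm (delta_mx 0 i).
have iZY : P.-integrable setT
    (fun w => (oracle_error k t w 0 i * (v - u k t.-1 w) 0 i)%:E).
  have ig := integrableD measurableT (integrableZl measurableT (c ^+ 2) iD)
    (integrableZl measurableT (K ^+ 2) gi).
  apply: (le_integrable measurableT _ _ ig) => [|w _].
    apply/measurable_EFinP; apply: measurable_funM => //.
    by apply: (measurable_fun_sub hi); exact: measurable_wrt_fun.
  rewrite /= lee_fin.
  have h1 := coord_le_dual nrmP (oracle_error k t w) i.
  have h2 : `|(v - u k t.-1 w) 0 i| <= K * nrm (u k t.-1 w - v).
    by rewrite (nrm_sub nrmP); apply: le_trans (coord_le_norm _ _) (hK _).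
  have h3 := gle w.
  rewrite normrM; set x := `|_| in h1 *; set y := `|_| in h2 *.
  have x0 : 0 <= x by exact: normr_ge0. have y0 : 0 <= y by exact: normr_ge0.
  apply: le_trans (ler_norm _).
  have h4 : x ^+ 2 <= (dual_norm nrm (oracle_error k t w) * c) ^+ 2.
    by rewrite ler_sqr ?nnegrE// (le_trans x0).
  have h5 : y ^+ 2 <= (K * nrm (u k t.-1 w - v)) ^+ 2.
    by rewrite ler_sqr ?nnegrE// (le_trans y0).
  have h6 := ler_wpM2l (sqr_ge0 K) h3.
  have := sqr_ge0 (x - y); rewrite !exprMn in h4 h5.
  have := sqr_ge0 x; have := sqr_ge0 y; lra.
apply: dominated_integrable => //.
rewrite (integral_mul_eq0 hi mY iZ _ iZY)// => A hA.
by have [] := oracle_error_mean0 i hk ht hA.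
Qed.

End Oracle.

(** * The outer loop *)

Section OuterLoop.
Context {R : realType} {n : nat} (X : set 'rV[R]_n) (nrm : 'rV[R]_n -> R).
Variables (f h chi om : 'rV[R]_n -> R) (gf gom : 'rV[R]_n -> 'rV[R]_n).
Variables (heta : R -> 'rV[R]_n -> R) (gheta : R -> 'rV[R]_n -> 'rV[R]_n).
Variables (nu mu L Bh Ch Lh lambda gamma beta : R).
Variables (eta alpha p : nat -> R) (N : nat) (T : nat -> nat) (x0 xstar : 'rV[R]_n).
Let Psi z := f z + h z + chi z.
Hypotheses (nrmP : is_norm nrm) (convX : convex_set (M := 'rV[R]_n) X)
  (omP : is_dgf nrm X nu om gom)
  (Vle : forall x z, X x -> X z -> bregman om gom x z <= 2^-1 * nrm (x - z) ^+ 2)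
  (cchi : convex_function (E := 'rV[R]_n) X chi)
  (mu0 : 0 < mu) (schi : strongly_convex nrm X mu chi) (Bh0 : 0 < Bh)
  (sa : smooth_approx nrm X h heta gheta Bh Ch)
  (cf : convex_function (E := 'rV[R]_n) X f) (gfP : is_gradient X f gf) (L0 : 0 < L)
  (smf : forall x y, X x -> X y ->
    f x <= f y + dotp (gf y) (x - y) + L / 2 * nrm (x - y) ^+ 2)
  (xsP : is_argmin X Psi xstar).
Hypotheses (Lh0 : 0 < Lh) (LLh : L <= Lh) (lambda01 : 0 < lambda <= 2^-1)
  (gammaE : gamma = lambda / 2) (betaE : beta * nu = Lh * gamma) (beta0 : 0 <= beta)
  (gbmu : 2 * gamma * (beta + mu) <= mu)
  (eta0 : forall k, 0 < eta k) (eta_le : forall k, eta k.+1 <= eta k)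
  (alpha0 : forall k, 0 < alpha k) (alpha14 : forall k, alpha k <= 4^-1)
  (Calpha : forall k, Ch / eta k * alpha k ^+ 2 <= Lh / 16)
  (pE : forall k, p k * alpha k = 1 - alpha k)
  (alphaT : forall k, (1 - alpha k) ^+ T k = 2^-1).

Let nu0 : 0 < nu. Proof. by case: omP. Qed.
Let lbm0 : 0 < lambda * (beta + mu).
Proof.
by case/andP: lambda01 => l0 _; rewrite mulr_gt0// ltr_wpDl.
Qed.
Let Xxs : X xstar. Proof. by case: xsP. Qed.
Let V_ge0 y z : X y -> X z -> 0 <= bregman om gom y z.
Proof. exact: (bregman_ge0 convX nrmP omP). Qed.

(** * Path-wise estimates across outer iterations *)

Section Path.
Context {Xi : Type} (H : R -> 'rV[R]_n -> Xi -> 'rV[R]_n) (xi : nat -> nat -> Xi).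
Variables (x xbar xund : nat -> 'rV[R]_n) (u util uund : nat -> nat -> 'rV[R]_n).
Hypothesis alg : RF_ASSGS X f gf heta H chi om gom
     (fun=> gamma) (fun=> lambda) (fun=> beta) eta
     (fun k _ => alpha k) (fun k _ => p k) (fun k _ => p k * mu) N T
     xi x0 x xbar xund u util uund.
Let V := bregman om gom.

Definition error k t := H (eta k) (uund k t) (xi k t) - gheta (eta k) (uund k t).

Definition noise k t : R :=
  lambda * dotp (error k t) (xstar - u k t.-1)
  + 8 / 5 * alpha k / Lh * dual_norm nrm (error k t) ^+ 2.

(* The smoothing parameter is already the one of the next outer iteration, so
   that [gap] includes the starting point k = 0. *)
Definition gap k : R :=
  f (xbar k) + heta (eta k.+1) (xbar k) + chi (xbar k) - Psi xstar
  + Bh * eta k.+1 + lambda * (beta + mu) * V (x k) xstar.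

Let inner k (hk : (1 <= k <= N)%N) (Xx : X (x k.-1)) (Xxb : X (xbar k.-1)) :
  (forall t, (t <= T k)%N -> X (u k t) /\ X (util k t)) /\
  (forall t v W y, (t <= T k)%N -> X v -> W = 1 - (1 - alpha k) ^+ t ->
    y = (1 - lambda) *: xbar k.-1 + lambda *: util k t ->
    f y + heta (eta k) y + chi y + lambda * (beta + mu) * V (u k t) v
    <= (1 - lambda * W)
         * (f (xbar k.-1) + heta (eta k) (xbar k.-1) + chi (xbar k.-1))
       + lambda * W * (f v + heta (eta k) v + chi v)
       + (lambda * (beta + mu) * (1 - alpha k) ^+ t + lambda * beta * W)
         * V (x k.-1) v
       + L / 2 * gamma ^+ 2 * (1 - 2 * W) * nrm (xbar k.-1 - x k.-1) ^+ 2
       + wsum (alpha k) (fun t => lambda * dotp (error k t) (v - u k t.-1)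
           + 8 / 5 * alpha k / Lh * dual_norm nrm (error k t) ^+ 2) t).
Proof.
have e0 := eta0 k.
have [chk [ghk _]] := (sa_convex sa e0, sa_C1 sa e0).
have liph := fun y y' => @sa_lipschitz _ _ _ _ _ _ _ _ _ sa (eta k) y y' e0.
have ut0 := alg_util0 alg hk; have u0 := alg_u0 alg hk.
have uuE := fun t => alg_uund alg (t := t) hk.
have utE := fun t => alg_util alg (t := t) hk.
have umin := fun t => alg_u alg (t := t) hk.
have xuE := alg_xund alg hk.
split=> [t tT|t v W y tT Xv WE ->].
  exact: (inner_in convX (alpha0 k) (alpha14 k) Xx Xxb u0 ut0 umin utE tT).
have W12 : 2 * W <= 1.
  have : (1 - alpha k) ^+ T k <= (1 - alpha k) ^+ t.
    have ha := alpha0 k; have hb := alpha14 k.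
    by apply: ler_wiXn2l => //; lra.
  by rewrite alphaT WE; lra.
move: W12; rewrite WE => W12.
exact: (inner_bound nrmP convX omP Vle cchi mu0 schi chk ghk liph cf gfP smf
   Lh0 L0 LLh lambda01 gammaE betaE beta0 (alpha0 k) (alpha14 k) (Calpha k) (pE k)
   Xx Xxb xuE u0 ut0 uuE umin utE tT Xv W12).
Qed.

Lemma outer_in k : (k <= N)%N -> X (x k) /\ X (xbar k).
Proof.
elim: k => [|k IH] kN.
  by have [X0 ->] := alg_x0 alg; rewrite (alg_xbar0 alg).
have [Xx Xxb] := IH (ltnW kN).
have hk : (1 <= k.+1 <= N)%N by [].
have [/(_ (T k.+1) (leqnn _))[Xu Xut] _] := inner hk Xx Xxb.
rewrite (alg_x alg hk) (alg_xbar alg hk); split => //.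
by apply: (convex_setP convX) => //; move: lambda01; lra.
Qed.

Lemma inner_iterate_in k t : (1 <= k <= N)%N -> (t <= T k)%N ->
  X (u k t) /\ X (util k t).
Proof.
move=> hk tT; have [Xx Xxb] : X (x k.-1) /\ X (xbar k.-1).
  by apply: outer_in; case/andP: hk => _; apply: leq_trans (leq_pred _).
by have [/(_ t tT)] := inner hk Xx Xxb.
Qed.

Lemma gap_ge k : (k <= N)%N ->
  Psi (xbar k) - Psi xstar + lambda * (beta + mu) * V (x k) xstar <= gap k.
Proof.
move=> kN; have [_ Xxb] := outer_in kN.
have /andP[_] := sa_approx sa (eta0 k.+1) Xxb.
rewrite /gap /Psi; lra.
Qed.

Lemma gap0_le Delta0 :
  Psi x0 - Psi xstar + lambda * (beta + mu) * V x0 xstar <= Delta0 ->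
  gap 0 <= Delta0 + Bh * eta 1.
Proof.
have [X0 xE] := alg_x0 alg.
have /andP[+ _] := sa_approx sa (eta0 1) X0.
rewrite /gap /Psi xE (alg_xbar0 alg); lra.
Qed.

(** Passing from eta_k to eta_{k+1} raises the smoothed function by at most B_h (eta_k - eta_{k+1}),
    which is exactly the drop of the bias term in [gap]. The change of smoothing is therefore free,
    and only gamma B_h eta_k remains. *)
Lemma outer_step k : (1 <= k <= N)%N ->
  gap k <= (1 - gamma) * gap k.-1 + gamma * (Bh * eta k)
           + wsum (alpha k) (noise k) (T k).
Proof.
move=> hk; have /andP[k1 kN] := hk.
have [Xx Xxb] : X (x k.-1) /\ X (xbar k.-1).
  by apply: outer_in; exact: leq_trans (leq_pred _) kN.
have [Xxk Xxbk] := outer_in kN.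
have [_ ib] := inner hk Xx Xxb.
have := ib _ xstar _ _ (leqnn (T k)) Xxs erefl erefl.
rewrite -(alg_xbar alg hk) -(alg_x alg hk) alphaT -/(noise k) => {}ib.
have /andP[hs _] := sa_approx sa (eta0 k) Xxs.
have /andP[_ mono] := sa_monotone sa (eta0 k.+1) (eta_le k) Xxbk.
have V0 : 0 <= V (x k.-1) xstar := V_ge0 Xx Xxs.
have E1 : 1 - lambda * (1 - 2^-1) = 1 - gamma by rewrite gammaE; field.
have E2 : lambda * (1 - 2^-1) = gamma by rewrite gammaE; field.
have E3 : lambda * (beta + mu) / 2 + lambda * beta * (1 - 2^-1) = gamma * (2 * beta + mu).
  by rewrite gammaE; field.
have E4 : 1 - 2 * (1 - 2^-1) = 0 :> R by field.
rewrite E1 E2 E3 E4 mulr0 mul0r addr0 in ib.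
have g0 : 0 <= gamma by rewrite gammaE; move: lambda01; lra.
(* The left side is the coefficient of V left by the inner loop; [gbmu] is precisely what makes it
   contract. *)
have h1 : gamma * (2 * beta + mu) <= (1 - gamma) * (lambda * (beta + mu)).
  have -> : lambda = 2 * gamma by rewrite gammaE; field.
  have := ler_wpM2l g0 gbmu; lra.
have h2 := ler_wpM2r V0 h1.
have h3 := ler_wpM2l g0 hs.
rewrite /gap prednK// /Psi; lra.
Qed.

Lemma inner_distance k t : (1 <= k <= N)%N -> (t <= T k)%N ->
  lambda * (beta + mu) * (nu / 2) * nrm (u k t - xstar) ^+ 2
  <= gap k.-1 + Bh * eta k + L / 2 * gamma ^+ 2 * nrm (xbar k.-1 - x k.-1) ^+ 2
     + wsum (alpha k) (noise k) t.
Proof.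
move=> hk tT; have /andP[k1 kN] := hk.
have kN' : (k.-1 <= N)%N by exact: leq_trans (leq_pred _) kN.
have [Xx Xxb] := outer_in kN'.
have [_ ib] := inner hk Xx Xxb.
have [Xu Xut] := inner_iterate_in hk tT.
have := ib _ xstar _ _ tT Xxs erefl erefl.
have l01 : 0 <= lambda <= 1 by move: lambda01; lra.
have Xy := convex_setP convX Xxb Xut l01; rewrite -/(seg _ _ _).
set W := 1 - _; rewrite -/(noise k) => {}ib.
have ha0 := alpha0 k; have ha1 := alpha14 k.
have W01 : 0 <= W <= 1.
  rewrite /W subr_ge0 exprn_ile1/=; [|lra|lra].
  by rewrite lerBlDr lerDl exprn_ge0//; lra.
have cE : (1 - alpha k) ^+ t = 1 - W by rewrite /W; ring.
have [_ /(_ _ Xy) opt] := xsP.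
have /andP[hs _] := sa_approx sa (eta0 k) Xxs.
have /andP[_ hy] := sa_approx sa (eta0 k) Xy.
have /andP[_ hxb] := sa_approx sa (eta0 k) Xxb.
have [_ /(_ _ Xxb) optb] := xsP.
have V0 : 0 <= V (x k.-1) xstar := V_ge0 Xx Xxs.
have h1 := ler_wpM2l (ltW lbm0) (bregman_ge convX nrmP omP Xu Xxs).
rewrite cE in ib.
have /andP[W0 W1] := W01.
have lW0 : 0 <= lambda * W by apply: mulr_ge0 => //; move: lambda01; lra.
have lW1 : lambda * W <= 1 by apply: mulr_ile1 => //; move: lambda01; lra.
have h2 : (lambda * (beta + mu) * (1 - W) + lambda * beta * W) * V (x k.-1) xstar
    <= lambda * (beta + mu) * V (x k.-1) xstar.
  apply: ler_wpM2r => //.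
  have := mulr_ge0 lW0 (ltW mu0); lra.
have h3 := ler_wpM2l lW0 hs.
(* Minimality of [xstar] and the bias bound make this smoothed gap nonnegative, so its factor 1 -
   lambda W may be replaced by 1. *)
have d0 : 0 <= f (xbar k.-1) + heta (eta k) (xbar k.-1) + chi (xbar k.-1)
   - Psi xstar + Bh * eta k.
  by move: optb hxb; rewrite /Psi; lra.
have h4 := mulr_ge0 lW0 d0.
have b0 : 0 <= Bh * eta k by rewrite mulr_ge0 ?ltW.
have h5 : lambda * W * (Bh * eta k) <= Bh * eta k by rewrite ler_piMl.
have h6 : L / 2 * gamma ^+ 2 * (1 - 2 * W) * nrm (xbar k.-1 - x k.-1) ^+ 2
   <= L / 2 * gamma ^+ 2 * nrm (xbar k.-1 - x k.-1) ^+ 2.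
  apply: ler_wpM2r; first exact: sqr_ge0.
  rewrite ler_piMr ?(mulr_ge0 _ (sqr_ge0 _))//; move: L0 W0; lra.
rewrite /gap prednK//; move: opt h1 h2 h3 h4 h5 h6 hy ib; rewrite /Psi /V; lra.
Qed.

End Path.

(** * Integrable majorants along the outer loop *)

Section Expectation.
Context {d d' : measure_display} {Omega : measurableType d} {Xi : measurableType d'}.
Variables (P : probability Omega R) (H : R -> 'rV[R]_n -> Xi -> 'rV[R]_n)
  (xi : nat -> nat -> Omega -> Xi) (x xbar xund : nat -> Omega -> 'rV[R]_n)
  (u util uund : nat -> nat -> Omega -> 'rV[R]_n) (sigma : R).
Hypothesis alg : forall w, RF_ASSGS X f gf heta H chi om gom
     (fun=> gamma) (fun=> lambda) (fun=> beta) eta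
     (fun k _ => alpha k) (fun k _ => p k) (fun k _ => p k * mu) N T
     (fun k t => xi k t w) x0
     (fun k => x k w) (fun k => xbar k w) (fun k => xund k w)
     (fun k t => u k t w) (fun k t => util k t w) (fun k t => uund k t w).
Hypothesis so : stochastic_oracle P nrm gheta H eta N T xi u uund sigma.

Let gap_ k w := gap (fun k => x k w) (fun k => xbar k w) k.
Let noise_ k t w :=
  noise H (fun k t => xi k t w) (fun k t => u k t w) (fun k t => uund k t w) k t.
Let bounded (F : Omega -> 'rV[R]_n) :=
  exists b, dominated P (fun w => nrm (F w - xstar) ^+ 2) b.

(** The factor 4 / 5 is the 8 / 5 of a single step times the total inner weight 1/2. *)
Fixpoint gap_bound (Delta0 : R) k : R :=
  if k is k'.+1
  then (1 - gamma) * gap_bound Delta0 k' + gamma * (Bh * eta k)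
       + 4 / 5 * alpha k / Lh * sigma ^+ 2
  else Delta0 + Bh * eta 1.

Let noise_dominated k t : (1 <= k <= N)%N -> (1 <= t <= T k)%N ->
  bounded (u k t.-1) -> dominated P (noise_ k t) (8 / 5 * alpha k / Lh * sigma ^+ 2).
Proof.
move=> hk ht [b /(oracle_error_dotp nrmP so hk ht) h1].
have [i2 l2] := oracle_error_sqr so hk ht.
have c0 : 0 <= 8 / 5 * alpha k / Lh.
  by apply: divr_ge0; [have := alpha0 k; lra|exact: ltW].
have l0 : 0 <= lambda by move: lambda01; lra.
have := dominatedD (dominatedZ l0 h1) (dominatedZ c0 (dominated_integrable i2 l2)).
by rewrite mulr0 add0r.
Qed.

(** Strong induction is needed: the distance bound for u_t sums the noise of steps 1 to t, and
    dominating that noise uses all of u_0, ..., u_{t-1}. *)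
Let inner_bounded k b : (1 <= k <= N)%N -> dominated P (gap_ k.-1) b ->
  bounded (x k.-1) -> bounded (xbar k.-1) ->
  forall t, (t <= T k)%N -> bounded (u k t) /\ bounded (util k t).
Proof.
move=> hk Dgap Bx Bxb; elim/ltn_ind => -[_ _|t IH tT].
  have uE w : u k 0%N w = x k.-1 w := alg_u0 (alg w) hk.
  have vE w : util k 0%N w = xbar k.-1 w := alg_util0 (alg w) hk.
  by split; [rewrite (_ : u k 0%N = x k.-1)|rewrite (_ : util k 0%N = xbar k.-1)]
    => //; apply/funext.
have ha0 := alpha0 k; have ha1 := alpha14 k.
have a01 : 0 <= alpha k <= 1 by lra.
have Dn : dominated P (fun w => wsum (alpha k) (fun s => noise_ k s w) t.+1)
    (wsum (alpha k) (fun=> 8 / 5 * alpha k / Lh * sigma ^+ 2) t.+1).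
  apply: dominated_wsum => // s /andP[s1 st].
  apply: noise_dominated => //; first by rewrite s1 (leq_trans st).
  have st' : (s.-1 < t.+1)%N by rewrite prednK.
  by have [] := IH _ st' (ltnW (leq_trans st' tT)).
have Bu : bounded (u k t.+1).
  have [bx Dx] := Bx; have [bxb Dxb] := Bxb.
  pose c := (lambda * (beta + mu) * (nu / 2))^-1.
  have c0 : 0 < lambda * (beta + mu) * (nu / 2) by apply: mulr_gt0 => //; apply: divr_gt0.
  have h2 : 0 <= (2 : R) by [].
  have q0 : 0 <= L / 2 * gamma ^+ 2 by rewrite mulr_ge0 ?sqr_ge0//; move: L0; lra.
  have D1 := dominatedZ q0 (dominatedD (dominatedZ h2 Dxb) (dominatedZ h2 Dx)).
  have D2 := dominatedD (dominatedD (dominatedD Dgap (dominated_cst P (Bh * eta k))) D1) Dn.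
  have ci : 0 <= c by rewrite invr_ge0 ltW.
  eexists; apply: (dominated_le (dominatedZ ci D2) (lexx _)) => w.
  rewrite ler_pdivlMl//.
  apply: le_trans (inner_distance (alg w) hk tT) _.
  rewrite lerD2r lerD2l; apply: ler_wpM2l => //.
  have := nrm_sqr_add nrmP (xbar k.-1 w - xstar) (xstar - x k.-1 w).
  by rewrite addrA subrK (nrm_sub nrmP xstar).
split => //; have [_ [bt Dt]] := IH _ (ltnSn t) (ltnW tT).
have [bu Du] := Bu; eexists.
have h1 : 0 <= 1 - alpha k by lra.
apply: (dominated_le (dominatedD (dominatedZ h1 Dt) (dominatedZ (ltW ha0) Du)) (lexx _)) => w.
have ht : (1 <= t.+1 <= T k)%N by [].
rewrite (alg_util (alg w) hk ht) /=.
rewrite (_ : _ - xstar = (1 - alpha k) *: (util k t w - xstar)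
  + alpha k *: (u k t.+1 w - xstar)); first exact: nrm_sqr_conv.
by apply/rowP => i; rewrite !mxE; ring.
Qed.

Let gap_bounded k b : (k <= N)%N -> dominated P (gap_ k) b -> bounded (x k).
Proof.
move=> kN Dg.
have c0 : 0 < lambda * (beta + mu) * (nu / 2) by apply: mulr_gt0 => //; apply: divr_gt0.
have ci : 0 <= (lambda * (beta + mu) * (nu / 2))^-1 by rewrite invr_ge0 ltW.
eexists; apply: (dominated_le (dominatedZ ci Dg) (lexx _)) => w.
rewrite ler_pdivlMl//; apply: le_trans (gap_ge (alg w) kN).
have [Xx Xxb] := outer_in (alg w) kN.
have [_ /(_ _ Xxb) opt] := xsP.
have := ler_wpM2l (ltW lbm0) (bregman_ge convX nrmP omP Xx Xxs).
move: opt; lra.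
Qed.

Lemma gap_dominated Delta0 k :
  Psi x0 - Psi xstar + lambda * (beta + mu) * bregman om gom x0 xstar <= Delta0 ->
  (k <= N)%N ->
  dominated P (gap_ k) (gap_bound Delta0 k) /\ bounded (xbar k).
Proof.
move=> hD; elim: k => [|k IH] kN.
  split; last first.
    exists (nrm (x0 - xstar) ^+ 2); apply: (dominated_le (dominated_cst P _)) => // w.
    by rewrite (alg_xbar0 (alg w)).
  by apply: (dominated_le (dominated_cst P _)) => // w; exact: (gap0_le (alg w)).
have [Dg Bxb] := IH (ltnW kN).
have Bx := gap_bounded (ltnW kN) Dg.
have hk : (1 <= k.+1 <= N)%N by [].
have IB := inner_bounded hk Dg Bx Bxb.
have ha0 := alpha0 k.+1; have ha1 := alpha14 k.+1.
have a01 : 0 <= alpha k.+1 <= 1 by lra.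
split.
  have Dn : dominated P (fun w => wsum (alpha k.+1) (fun s => noise_ k.+1 s w) (T k.+1))
      (4 / 5 * alpha k.+1 / Lh * sigma ^+ 2).
    rewrite (_ : 4 / 5 * alpha k.+1 / Lh * sigma ^+ 2 =
      wsum (alpha k.+1) (fun=> 8 / 5 * alpha k.+1 / Lh * sigma ^+ 2) (T k.+1)); last first.
      by rewrite wsum_cst alphaT; field; rewrite gt_eqF.
    apply: dominated_wsum => // s hs; apply: noise_dominated => //.
    have [s1 sT] := andP hs.
    by have [] := IB s.-1 (leq_trans (leq_pred _) sT).
  have g1 : 0 <= 1 - gamma by rewrite gammaE; move: lambda01; lra.
  apply: (dominated_le (dominatedD (dominatedD (dominatedZ g1 Dg)
    (dominated_cst P (gamma * (Bh * eta k.+1)))) Dn) (lexx _)) => w.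
  exact: (outer_step (alg w) hk).
have [_ [bt Dt]] := IB _ (leqnn _); have [bb Db] := Bxb.
have l0 : 0 <= lambda by move: lambda01; lra.
have l1 : 0 <= 1 - lambda by move: lambda01; lra.
eexists; apply: (dominated_le (dominatedD (dominatedZ l1 Db) (dominatedZ l0 Dt)) (lexx _)) => w.
rewrite (alg_xbar (alg w) hk) /=.
rewrite (_ : _ - xstar = (1 - lambda) *: (xbar k w - xstar)
  + lambda *: (util k.+1 (T k.+1) w - xstar)).
  by apply: nrm_sqr_conv => //; move: lambda01; lra.
by apply/rowP => i; rewrite !mxE; ring.
Qed.

Lemma expectation_le Delta0 :
  Psi x0 - Psi xstar + lambda * (beta + mu) * bregman om gom x0 xstar <= Delta0 ->
  ('E_P[(fun w => Psi (xbar N w) - Psi xstar)%R] <= (gap_bound Delta0 N)%:E)%E.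
Proof.
move=> hD; have [Dg _] := gap_dominated hD (leqnn N).
apply: dominated_expectation => [w|].
  have [_ Xxb] := outer_in (alg w) (leqnn N).
  by rewrite subr_ge0; case: xsP => _; apply.
apply: (dominated_le Dg (lexx _)) => w.
apply: le_trans (gap_ge (alg w) (leqnn N)).
have [Xx _] := outer_in (alg w) (leqnn N).
by rewrite lerDl mulr_ge0 ?(ltW lbm0)// V_ge0.
Qed.

End Expectation.
End OuterLoop.

(** * The step-size schedule *)

Section LogsAndRoots.
Context {R : realType}.
Implicit Types (a x r g : R) (k N T : nat).

Lemma nceil_ge x : x <= (nceil x)%:R.
Proof.
apply: le_trans (ceil_ge x) _; rewrite /nceil pmulrn ler_int.
exact: lez_abs.
Qed.

Lemma nceil_le x : 0 <= x -> (nceil x)%:R <= x + 1.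
Proof.
move=> x0; rewrite /nceil pmulrn gez0_abs ?ceil_ge0; last by lra.
by have := ceilB1_lt x; rewrite intrB => /ltW; lra.
Qed.

Lemma nceil_gt0 x : 0 < x -> (0 < nceil x)%N.
Proof. by move=> x0; rewrite -(ltr_nat R); apply: lt_le_trans x0 (nceil_ge x). Qed.

Lemma powR_half_nat a k : 0 <= a -> a `^ (k%:R / 2) = Num.sqrt a ^+ k.
Proof.
move=> a0; rewrite mulrC powRrM powR_mulrn ?powR_ge0//.
by rewrite powR12_sqrt.
Qed.

Lemma ln_le_sub1 x : 0 < x -> ln x <= x - 1.
Proof.
move=> x0; have -> : x = 1 + (x - 1) by ring.
by apply: le_trans (le_ln1Dx _) _; lra.
Qed.

Lemma ln2_bounds : 0 < ln (2 : R) <= 1.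
Proof.
apply/andP; split; first by rewrite ln_gt0// ltr1n.
have := ln_le_sub1 (ltr0Sn R 1); lra.
Qed.

Lemma ln_half : ln (2^-1 : R) = - ln 2.
Proof. by rewrite lnV// posrE. Qed.

Lemma le_of_ln x y : 0 < x -> 0 < y -> ln x <= ln y -> x <= y.
Proof. by move=> x0 y0; rewrite ler_ln. Qed.

Lemma half_root_pow T : (0 < T)%N -> (2 `^ (- T%:R^-1) : R) ^+ T = 2^-1.
Proof.
move=> T0; rewrite -powR_mulrn ?powR_ge0// -powRrM mulNr mulVf ?pnatr_eq0 -?lt0n//.
by rewrite powRN powRr1.
Qed.

(** With alpha = 1 - 2^(-1/T) this reads alpha <= (log 2) / T, the form in which a large T damps the
    noise. *)
Lemma half_root_ge T : (1 - ln 2 / T%:R <= 2 `^ (- T%:R^-1) :> R).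
Proof.
have -> : (2 : R) `^ (- T%:R^-1) = expR (- (ln 2 / T%:R)).
  by rewrite /powR pnatr_eq0/= mulNr mulrC.
exact: expR_ge1Dx.
Qed.

Lemma half_root_lt1 T : (0 < T)%N -> (2 `^ (- T%:R^-1) < 1 :> R).
Proof.
move=> T0; rewrite ltNge; apply/negP => h.
by have := exprn_ege1 T h; rewrite half_root_pow//; lra.
Qed.

(** The bound on [T] says (1 - a)^T <= 1/2; taking T-th roots yields alpha <= a for alpha = 1 -
    2^(-1/T). *)
Lemma half_root_ge_of_log a T : 0 < a < 1 -> (0 < T)%N ->
  ln (2^-1) / ln (1 - a) <= T%:R -> 1 - a <= 2 `^ (- T%:R^-1).
Proof.
move=> /andP[a0 a1] T0 hT.
have a1' : 0 < 1 - a by lra.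
have l0 : ln (1 - a) < 0 by apply: ln_lt0; lra.
have h : (1 - a) ^+ T <= 2^-1.
  apply: le_of_ln; rewrite ?exprn_gt0 ?invr_gt0//.
  by rewrite lnXn// -[leLHS]mulr_natl -ler_ndivrMr.
rewrite -(@ler_pXn2r _ T)// ?nnegrE ?powR_ge0 ?(ltW a1')//.
by rewrite half_root_pow.
Qed.

Lemma log_half_div_le a : 0 < a < 1 -> 0 < ln (2^-1) / ln (1 - a) <= a^-1.
Proof.
move=> /andP[a0 a1].
have a1' : 0 < 1 - a by lra.
have l0 : ln (1 - a) < 0 by apply: ln_lt0; lra.
have /andP[h2 h2'] := ln2_bounds.
have hl : a <= - ln (1 - a) by have := ln_le_sub1 a1'; lra.
rewrite ln_half mulNr -mulrN -invrN; apply/andP; split.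
  by rewrite divr_gt0//; lra.
rewrite -[leRHS]mul1r; apply: ler_pM => //; first exact: ltW.
  by rewrite invr_ge0; lra.
by rewrite lef_pV2 ?posrE//; lra.
Qed.

Lemma sum_pow_le r N : 0 <= r < 1 ->
  \sum_(1 <= k < N.+1) r ^+ (N - k) <= (1 - r)^-1.
Proof.
move=> /andP[r0 r1]; have r1' : 0 < 1 - r by lra.
rewrite -[leRHS]mul1r ler_pdivlMr//.
suff -> : (\sum_(1 <= k < N.+1) r ^+ (N - k)) * (1 - r) = 1 - r ^+ N.
  by rewrite gerBl exprn_ge0.
elim: N => [|N IH]; first by rewrite big_geq// expr0; ring.
rewrite big_nat_recr//= subnn expr0.
have -> : \sum_(1 <= k < N.+1) r ^+ (N.+1 - k) = r * \sum_(1 <= k < N.+1) r ^+ (N - k).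
  by rewrite big_distrr/=; apply: eq_big_nat => k /andP[_ kN]; rewrite subSn// exprS.
by rewrite mulrDl -mulrA IH exprS; ring.
Qed.

Lemma sum_invpow_le (v : R) N : 0 < v < 1 ->
  \sum_(1 <= k < N.+1) (v ^+ k)^-1 <= (v ^+ N)^-1 / (1 - v).
Proof.
move=> /andP[v0 v1]; have v1' : 0 < 1 - v by lra.
suff -> : \sum_(1 <= k < N.+1) (v ^+ k)^-1 = ((v ^+ N)^-1 - 1) / (1 - v).
  by rewrite ler_pM2r ?invr_gt0// gerBl.
elim: N => [|N IH]; first by rewrite big_geq// expr0 invr1; ring.
rewrite big_nat_recr//= IH exprS.
have : v ^+ N != 0 by rewrite expf_neq0// gt_eqF.
move: (v ^+ N) => w w0; field; rewrite w0 !gt_eqF//.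
Qed.

End LogsAndRoots.

(* Without the noise [z] the recursion is solved exactly by
   [b k = (1 + r) * D * r ^+ k]. *)
Lemma noisy_recursion_le {R : realType} (r D e : R) (b z : nat -> R) N :
  0 < r < 1 -> 0 < D -> 0 < e -> (0 < N)%N -> b 0%N = (1 + r) * D ->
  (forall k, b k.+1 = r ^+ 2 * b k + (1 - r ^+ 2) * (D * r ^+ k.+1) + z k.+1) ->
  (forall k, (1 <= k <= N)%N ->
     z k * r ^+ (N - k) <= e * (1 - r) / (2 * (1 - r ^+ N))) ->
  4 * D * r ^+ N <= e -> b N <= e.
Proof.
move=> /andP[r0 r1] D0 e0 N0 b0 bS zle rN.
have rn1 : 0 < 1 - r ^+ N by rewrite subr_gt0 exprn_ilt1// ?ltW// -lt0n.
have r1' : 0 < 1 - r by lra.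
set q := e * (1 - r) / (2 * (1 - r ^+ N)) in zle.
(* The factor r^N lets the noise hypothesis be used as z_k r^N <= q r^k. The noise then adds up to a
   geometric sum, and [q] is the value for which it amounts to e / 2 at k = N. *)
have claim k : (k <= N)%N -> r ^+ N * b k <=
    r ^+ N * ((1 + r) * D * r ^+ k) + q * r ^+ k * (1 - r ^+ k) / (1 - r).
  elim: k => [_|k IH kN]; first by rewrite b0 expr0; lra.
  have hz : z k.+1 * r ^+ N <= q * r ^+ k.+1.
    have -> : r ^+ N = r ^+ (N - k.+1) * r ^+ k.+1 by rewrite -exprD subnK.
    by rewrite mulrA ler_wpM2r ?exprn_ge0 ?(ltW r0)// zle.
  have {}IH := ler_wpM2l (sqr_ge0 r) (IH (ltnW kN)).
  rewrite bS.
  have E : r ^+ 2 * (q * r ^+ k * (1 - r ^+ k) / (1 - r)) + q * r ^+ k.+1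
      = q * r ^+ k.+1 * (1 - r ^+ k.+1) / (1 - r).
    by rewrite (exprS r k); field; rewrite gt_eqF.
  rewrite -E; move: IH hz; rewrite (exprS r k); lra.
have rN0 : 0 < r ^+ N by rewrite exprn_gt0.
have := claim N (leqnn N).
have -> : q * r ^+ N * (1 - r ^+ N) / (1 - r) = r ^+ N * (e / 2).
  by rewrite /q; field; rewrite !gt_eqF.
rewrite -mulrDr ler_pM2l// => h; apply: le_trans h _.
have : (1 + r) * (D * r ^+ N) <= 2 * (D * r ^+ N).
  by apply: ler_wpM2r; [exact/ltW/mulr_gt0|lra].
move: rN; lra.
Qed.

(** * The parameter rules meet the requirements of the outer loop; operation counts *)

Section Schedule.
Context {R : realType}.
Variables nu mu L Bh Ch sigma Delta0 epsilon Lhat lambda gamma beta : R.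
Variables (eta alpha p : nat -> R) (N : nat) (T Tg Ts : nat -> nat).
Hypotheses (nu0 : 0 < nu) (mu0 : 0 < mu) (L0 : 0 < L) (Bh0 : 0 < Bh) (Ch0 : 0 < Ch)
  (D0 : 0 < Delta0) (e0 : 0 < epsilon) (eD : epsilon < 8 * Delta0).
Hypotheses (LhatE : Lhat = Num.max L (4 * nu * mu))
  (lambdaE : lambda = Num.sqrt (nu * mu / Lhat)) (gammaE : gamma = lambda / 2)
  (betaE : beta = Lhat * gamma / nu)
  (NE : N = nceil (2 * ln (8 * Delta0 / epsilon) / - ln (1 - gamma)))
  (etaE : forall k, eta k = Delta0 / Bh * (1 - gamma) `^ (k%:R / 2))
  (TgE : forall k, Tg k = nceil (ln (2^-1)
     / ln (1 - 4^-1 * Num.sqrt (Lhat / Num.max Lhat (Ch / eta k)))))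
  (TsE : forall k, Ts k = nceil (8 * sigma ^+ 2 * ln 2 * (1 - (1 - gamma) `^ (N%:R / 2))
           / (5 * Lhat * epsilon * (1 - Num.sqrt (1 - gamma)))
           * (1 - gamma) `^ ((N%:R - k%:R) / 2)))
  (TE : forall k, T k = maxn (Tg k) (Ts k))
  (alphaE : forall k, alpha k = 1 - 2 `^ (- (T k)%:R^-1))
  (pE : forall k, p k = (1 - alpha k) / alpha k).

Let numu0 : 0 < nu * mu. Proof. exact: mulr_gt0. Qed.

Lemma Lhat_gt0 : 0 < Lhat.
Proof. by rewrite LhatE lt_max L0. Qed.

Lemma L_le_Lhat : L <= Lhat.
Proof. by rewrite LhatE le_max lexx. Qed.

Let numuLhat : 4 * (nu * mu) <= Lhat.
Proof. by rewrite LhatE le_max mulrA lexx orbT. Qed.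

Let lambda_sqr : lambda ^+ 2 * Lhat = nu * mu.
Proof.
have h := Lhat_gt0; rewrite lambdaE sqr_sqrtr; last by rewrite divr_ge0 ?ltW.
by rewrite divfK// gt_eqF.
Qed.

Lemma lambda_itv : 0 < lambda <= 2^-1.
Proof.
have h := Lhat_gt0; rewrite {1}lambdaE sqrtr_gt0 divr_gt0//=.
rewrite -ler_sqr ?nnegrE ?invr_ge0//; last by rewrite lambdaE sqrtr_ge0.
rewrite -(ler_pM2r h) lambda_sqr; move: numuLhat; lra.
Qed.

Let lambda0 : 0 < lambda. Proof. by case/andP: lambda_itv. Qed.
Let gamma_itv : 0 < gamma <= 4^-1.
Proof. by rewrite gammaE; have := lambda_itv; lra. Qed.

Lemma beta_nu : beta * nu = Lhat * gamma.
Proof. by rewrite betaE divfK// gt_eqF. Qed.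

Lemma beta_ge0 : 0 <= beta.
Proof.
have h := Lhat_gt0; have /andP[g0 _] := gamma_itv.
by rewrite betaE divr_ge0 ?mulr_ge0 ?ltW.
Qed.

(** gamma beta = lambda^2 Lhat / (4 nu) = mu / 4 and gamma <= 1/4, so each of the two summands is at
    most mu / 2. *)
Lemma contraction_cond : 2 * gamma * (beta + mu) <= mu.
Proof.
have E : gamma * beta = mu / 4.
  have -> : gamma * beta = lambda ^+ 2 * Lhat / (4 * nu).
    by rewrite betaE gammaE; field; rewrite gt_eqF.
  by rewrite lambda_sqr; field; rewrite gt_eqF.
have /andP[_ g1] := gamma_itv.
have := ler_wpM2r (ltW mu0) g1; move: E; lra.
Qed.

Let r := Num.sqrt (1 - gamma).
Let g1 : 0 < 1 - gamma. Proof. by have := gamma_itv; lra. Qed.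
Let r2 : r ^+ 2 = 1 - gamma. Proof. by rewrite sqr_sqrtr// ltW. Qed.
Let r0 : 0 < r. Proof. by rewrite sqrtr_gt0. Qed.
Let r1 : r < 1.
Proof.
rewrite -ltr_sqr ?nnegrE ?(ltW r0)// r2 expr1n.
by have := gamma_itv; lra.
Qed.

Lemma Bh_eta k : Bh * eta k = Delta0 * r ^+ k.
Proof.
rewrite etaE powR_half_nat ?ltW// mulrA; congr (_ * _).
by rewrite mulrC divfK// gt_eqF.
Qed.

Lemma eta_gt0 k : 0 < eta k.
Proof. by rewrite etaE mulr_gt0 ?divr_gt0 ?powR_gt0. Qed.

Lemma eta_noninc k : eta k.+1 <= eta k.
Proof.
rewrite -(ler_pM2l Bh0) !Bh_eta ler_pM2l// exprS ler_piMl ?exprn_ge0 ?ltW//.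
Qed.

Let Leta_gt0 k : 0 < Ch / eta k. Proof. exact/divr_gt0/eta_gt0. Qed.

(** The threshold behind T_k^g: its square times max(Lhat, L_eta) is Lhat / 16, and [alpha k] stays
    below it. *)
Let a k := 4^-1 * Num.sqrt (Lhat / Num.max Lhat (Ch / eta k)).

Let a_sqr k : a k ^+ 2 * Num.max Lhat (Ch / eta k) = Lhat / 16.
Proof.
have h := Lhat_gt0.
have m0 : 0 < Num.max Lhat (Ch / eta k) by rewrite lt_max h.
rewrite /a exprMn sqr_sqrtr ?divr_ge0 ?ltW//.
by field; rewrite gt_eqF.
Qed.

Let a_itv k : 0 < a k <= 4^-1.
Proof.
have h := Lhat_gt0.
have m0 : 0 < Num.max Lhat (Ch / eta k) by rewrite lt_max h.
rewrite /a mulr_gt0 ?sqrtr_gt0 ?divr_gt0//= ger_pMr// -sqrtr1 ler_sqrt//.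
by rewrite ler_pdivrMr// mul1r le_max lexx.
Qed.

Let a01 k : 0 < a k < 1. Proof. by have := a_itv k; lra. Qed.

Lemma T_gt0 k : (0 < T k)%N.
Proof.
rewrite TE leq_max TgE nceil_gt0//.
by case/andP: (log_half_div_le (a01 k)).
Qed.

Lemma alpha_pow k : (1 - alpha k) ^+ T k = 2^-1.
Proof. by rewrite alphaE subKr half_root_pow// T_gt0. Qed.

Lemma alpha_gt0 k : 0 < alpha k.
Proof. by rewrite alphaE subr_gt0 half_root_lt1// T_gt0. Qed.

Let alpha_le_a k : alpha k <= a k.
Proof.
have : 1 - a k <= 2 `^ (- (T k)%:R^-1).
  apply: half_root_ge_of_log (a01 k) (T_gt0 k) _.
  apply: le_trans (nceil_ge _) _.
  by rewrite ler_nat TE leq_max TgE leqnn.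
by rewrite alphaE; lra.
Qed.

Lemma alpha_le4 k : alpha k <= 4^-1.
Proof. by apply: le_trans (alpha_le_a k) _; case/andP: (a_itv k). Qed.

Lemma alpha_lipschitz k : Ch / eta k * alpha k ^+ 2 <= Lhat / 16.
Proof.
rewrite -(a_sqr k) mulrC; apply: ler_pM; rewrite ?sqr_ge0 ?(ltW (Leta_gt0 k))//.
  rewrite ler_sqr ?nnegrE ?alpha_le_a ?(ltW (alpha_gt0 k))//.
  by case/andP: (a_itv k) => /ltW.
by rewrite le_max lexx orbT.
Qed.

Lemma p_alpha k : p k * alpha k = 1 - alpha k.
Proof. by rewrite pE divfK// gt_eqF// alpha_gt0. Qed.

Let logD0 : 0 < ln (8 * Delta0 / epsilon).
Proof. by apply: ln_gt0; rewrite ltr_pdivlMr// mul1r. Qed.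

Let logg0 : 0 < - ln (1 - gamma).
Proof. by rewrite oppr_gt0; apply: ln_lt0; have := gamma_itv; lra. Qed.

Lemma N_gt0 : (0 < N)%N.
Proof. by rewrite NE nceil_gt0// divr_gt0// mulr_gt0. Qed.

Let ln_r : ln (1 - gamma) = 2 * ln r.
Proof. by rewrite -r2 lnXn// mulr_natl. Qed.

Lemma rN_le : r ^+ N <= epsilon / (8 * Delta0).
Proof.
have h : 0 < epsilon / (8 * Delta0) by rewrite divr_gt0// mulr_gt0.
apply: le_of_ln => //; first by rewrite exprn_gt0.
have -> : epsilon / (8 * Delta0) = (8 * Delta0 / epsilon)^-1 by rewrite invf_div.
rewrite lnV ?posrE ?divr_gt0 ?mulr_gt0// lnXn// -[leLHS]mulr_natl.
have := nceil_ge (2 * ln (8 * Delta0 / epsilon) / - ln (1 - gamma)).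
by rewrite -NE ler_pdivrMr// ln_r; lra.
Qed.

(** The ceiling in [N] overshoots by at most one step, so r^N falls below its target by at most a
    factor r. The total inner cost, which grows like an inverse power of r^N, needs this
    direction. *)
Lemma rN_ge : epsilon / (8 * Delta0) * r <= r ^+ N.
Proof.
have h : 0 < epsilon / (8 * Delta0) by rewrite divr_gt0// mulr_gt0.
apply: le_of_ln; [exact: mulr_gt0|exact: exprn_gt0|].
have -> : epsilon / (8 * Delta0) = (8 * Delta0 / epsilon)^-1 by rewrite invf_div.
rewrite lnM ?posrE ?invr_gt0 ?divr_gt0 ?mulr_gt0//.
rewrite lnV ?posrE ?divr_gt0 ?mulr_gt0// lnXn// -[leRHS]mulr_natl.
have := @nceil_le R (2 * ln (8 * Delta0 / epsilon) / - ln (1 - gamma)).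
rewrite -NE => /(_ (ltW (divr_gt0 (mulr_gt0 (ltr0Sn R 1) logD0) logg0))).
rewrite -lerBlDr ler_pdivlMr// ln_r; lra.
Qed.

Let rN1 : 0 < 1 - r ^+ N.
Proof. by rewrite subr_gt0 exprn_ilt1 ?(ltW r0)// -lt0n N_gt0. Qed.

Let r1' : 0 < 1 - r. Proof. by rewrite subr_gt0. Qed.

Let X := 8 * sigma ^+ 2 * ln 2 * (1 - r ^+ N) / (5 * Lhat * epsilon * (1 - r)).

Let Ts_eq k : (k <= N)%N -> Ts k = nceil (X * r ^+ (N - k)).
Proof.
move=> kN; rewrite TsE powR_half_nat ?(ltW g1)//.
by rewrite -natrB// powR_half_nat ?(ltW g1).
Qed.

Let X_ge0 : 0 <= X.
Proof.
have /andP[l2 _] := @ln2_bounds R; have h := Lhat_gt0.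
apply: divr_ge0.
  do 2!(apply: mulr_ge0; last exact: ltW).
  by apply: mulr_ge0 => //; exact: sqr_ge0.
by rewrite !mulr_ge0 ?(ltW h) ?(ltW e0) ?(ltW r1')//.
Qed.

(** alpha_k T_k <= log 2 converts the lower bound X r^(N - k) on T_k into an upper bound on alpha_k;
    [X] is the constant for which the result is exactly the right-hand side. *)
Lemma noise_le k : (1 <= k <= N)%N ->
  4 / 5 * alpha k / Lhat * sigma ^+ 2 * r ^+ (N - k)
  <= epsilon * (1 - r) / (2 * (1 - r ^+ N)).
Proof.
move=> /andP[k1 kN]; have h := Lhat_gt0.
have /andP[l2 _] := @ln2_bounds R.
have Tp : 0 < (T k)%:R :> R by rewrite ltr0n T_gt0.
have h1 : alpha k * (T k)%:R <= ln 2.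
  by rewrite -ler_pdivlMr// alphaE; have := @half_root_ge R (T k); lra.
have h2 : X * r ^+ (N - k) <= (T k)%:R.
  by apply: le_trans (nceil_ge _) _; rewrite -Ts_eq// ler_nat TE leq_maxr.
have h3 := le_trans (ler_wpM2l (ltW (alpha_gt0 k)) h2) h1.
have c0 : 0 <= epsilon * (1 - r) / (2 * (1 - r ^+ N)) / ln 2.
  by rewrite divr_ge0 ?(ltW l2)// divr_ge0// ltW// mulr_gt0.
have := ler_wpM2r c0 h3.
have -> : ln 2 * (epsilon * (1 - r) / (2 * (1 - r ^+ N)) / ln 2)
  = epsilon * (1 - r) / (2 * (1 - r ^+ N)).
  by field; rewrite !gt_eqF.
apply: le_trans; rewrite le_eqVlt; apply/orP; left; apply/eqP.
by rewrite /X; field; rewrite !gt_eqF.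
Qed.

Lemma gap_bound_le : gap_bound Bh Lhat gamma eta alpha sigma Delta0 N <= epsilon.
Proof.
apply: (@noisy_recursion_le R r Delta0 epsilon _
  (fun k => 4 / 5 * alpha k / Lhat * sigma ^+ 2) N) => //.
- by rewrite r0 r1.
- exact: N_gt0.
- by rewrite /= Bh_eta; ring.
- by move=> k /=; rewrite Bh_eta r2; ring.
- exact: noise_le.
have := rN_le; rewrite ler_pdivlMr ?mulr_gt0//.
have := mulr_gt0 D0 (exprn_gt0 N r0); lra.
Qed.

(** With S the square root, Lhat <= L + 4 nu mu <= (S + 2)^2 nu mu, while lambda^2 Lhat = nu mu. *)
Let inv_lambda_le : 1 <= lambda * (Num.sqrt (L / (nu * mu)) + 2).
Proof.
set S := Num.sqrt _; have S0 : 0 <= S by exact: sqrtr_ge0.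
have S2 : S ^+ 2 * (nu * mu) = L by rewrite sqr_sqrtr ?divfK ?divr_ge0 ?gt_eqF ?ltW.
rewrite -(@ler_pXn2r _ 2)// ?nnegrE ?mulr_ge0 ?addr_ge0 ?(ltW lambda0)//.
rewrite expr1n exprMn -(ler_pM2r Lhat_gt0) mul1r mulrAC lambda_sqr.
have : Lhat <= L + 4 * (nu * mu).
  by rewrite LhatE ge_max; move: numu0 L0; lra.
have := mulr_ge0 S0 (ltW numu0); move: S2; lra.
Qed.

(** log 8 <= 3, -log(1 - gamma) >= lambda / 2 and 1 / lambda <= 2 (1 + S) give 24; the ceiling adds
    1. *)
Lemma N_le : N%:R <= 25 * ((1 + Num.sqrt (L / (nu * mu)))
                       * (1 + ln (Num.max (Delta0 / epsilon) 1))).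
Proof.
set S := Num.sqrt _; have S0 : 0 <= S by exact: sqrtr_ge0.
set M := ln (Num.max _ _).
have M0 : 0 <= M by apply: ln_ge0; rewrite le_max lexx orbT.
have lM : ln (8 * Delta0 / epsilon) <= 3 * (1 + M).
  have -> : 8 * Delta0 / epsilon = 2 ^+ 3 * (Delta0 / epsilon) by field; rewrite gt_eqF.
  rewrite lnM ?posrE ?divr_gt0// lnXn// -[X in X + _]mulr_natl.
  have /andP[_ l2] := @ln2_bounds R.
  have : ln (Delta0 / epsilon) <= M.
    by rewrite ler_ln ?posrE ?divr_gt0// ?lt_max ?ltr01 ?orbT// le_max lexx.
  lra.
have hg : gamma <= - ln (1 - gamma) by have := ln_le_sub1 g1; lra.
have := @nceil_le R (2 * ln (8 * Delta0 / epsilon) / - ln (1 - gamma)).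
rewrite -NE => /(_ (ltW (divr_gt0 (mulr_gt0 (ltr0Sn R 1) logD0) logg0))) hN.
have h1 : 2 * ln (8 * Delta0 / epsilon) / - ln (1 - gamma)
    <= 24 * ((1 + S) * (1 + M)).
  rewrite ler_pdivrMr//.
  have SM0 : 0 <= 24 * ((1 + S) * (1 + M)) by rewrite !mulr_ge0 ?addr_ge0.
  apply: le_trans (ler_wpM2l SM0 hg).
  have h2 : 1 <= 2 * (lambda * (1 + S)).
    have := inv_lambda_le; rewrite -/S; have := mulr_ge0 (ltW lambda0) S0; lra.
  have M1 : 0 <= 1 + M by lra.
  have := ler_wpM2r M1 h2; rewrite gammaE; move: lM; lra.
have := mulr_ge0 S0 M0; move: S0 M0 hN h1; lra.
Qed.

(** A fourth root of 1 - gamma: T_k^g grows like the square root of 1 / eta_k, that is, like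
    v^-k. *)
Let v := Num.sqrt r.
Let v2 : v ^+ 2 = r. Proof. by rewrite sqr_sqrtr// ltW. Qed.
Let v0 : 0 < v. Proof. by rewrite sqrtr_gt0. Qed.
Let v1 : v < 1.
Proof. by rewrite -ltr_sqr ?nnegrE ?(ltW v0)// v2 expr1n. Qed.

Let A := Num.sqrt (Bh * Ch / (Delta0 * Lhat)).
Let A_ge0 : 0 <= A. Proof. exact: sqrtr_ge0. Qed.

Let Tg_le k : (Tg k)%:R <= 5 + 4 * (A * (v ^+ k)^-1).
Proof.
have h := Lhat_gt0.
have /andP[b1 b2] := log_half_div_le (a01 k).
have := nceil_le (ltW b1); rewrite -TgE => hT.
have sE : Num.sqrt (Ch / eta k / Lhat) = A * (v ^+ k)^-1.
  have -> : Ch / eta k / Lhat = Bh * Ch / (Delta0 * Lhat) * ((v ^+ k)^-1) ^+ 2.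
    rewrite exprVn -exprM mulnC exprM v2.
    have -> : eta k = Delta0 * r ^+ k / Bh by rewrite -Bh_eta; field; rewrite gt_eqF.
    by field; rewrite !gt_eqF// exprn_gt0.
  rewrite sqrtrM ?sqrtr_sqr ?ger0_norm ?invr_ge0 ?exprn_ge0 ?(ltW v0)//.
  by rewrite divr_ge0 ?mulr_ge0 ?ltW.
have ia : (a k)^-1 <= 4 * (1 + A * (v ^+ k)^-1).
  rewrite /a invfM invrK ler_pM2l// -sqrtrV ?invf_div; last first.
    by rewrite divr_ge0 ?(ltW h)// le_max (ltW h).
  rewrite -sE; case: (leP Lhat (Ch / eta k)) => _; first by rewrite lerDr.
  by rewrite divff ?gt_eqF// sqrtr1 lerDl sqrtr_ge0.
move: hT ia b2; lra.
Qed.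

(** The geometric sum is dominated by v^-N / (1 - v), of order sqrt(Delta0 / epsilon) / lambda. In
    the product with [A], Delta0 cancels and lambda^2 Lhat becomes nu mu. *)
Let sum_v_le : A * \sum_(1 <= k < N.+1) (v ^+ k)^-1
  <= 32 * Num.sqrt (Bh * Ch / (nu * mu * epsilon)).
Proof.
have h := Lhat_gt0.
have vv : 0 < v < 1 by rewrite v0 v1.
have s1 := sum_invpow_le N vv.
have r12 : 2^-1 <= r.
  have := ler_wpM2l (ltW r0) (ltW r1); rewrite -expr2 r2 mulr1.
  have := gamma_itv; lra.
pose Q := Num.sqrt (16 * Delta0 / epsilon).
have Q0 : 0 <= Q by exact: sqrtr_ge0.
have q0 : 0 < 16 * Delta0 / epsilon by rewrite divr_gt0 ?mulr_gt0.
have vN : 0 < v ^+ N by rewrite exprn_gt0.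
have s2 : (v ^+ N)^-1 <= Q.
  rewrite -ler_sqr ?nnegrE ?invr_ge0 ?(ltW vN)// sqr_sqrtr ?(ltW q0)//.
  rewrite exprVn -exprM mulnC exprM v2.
  rewrite -[leRHS]invrK lef_pV2 ?posrE ?invr_gt0 ?exprn_gt0//.
  apply: le_trans rN_ge; rewrite invf_div.
  have -> : epsilon / (16 * Delta0) = epsilon / (8 * Delta0) * 2^-1.
    by field; rewrite gt_eqF.
  by rewrite ler_wpM2l// divr_ge0 ?mulr_ge0 ?ltW.
(* gamma = 1 - v^4 <= 4 (1 - v) and lambda = 2 gamma. *)
have s3 : (1 - v)^-1 <= 8 / lambda.
  have vp : 0 < 1 - v by rewrite subr_gt0.
  rewrite -[leRHS]invrK lef_pV2 ?posrE ?invr_gt0 ?divr_gt0// invf_div.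
  have g4 : gamma = 1 - (v ^+ 2) ^+ 2 by rewrite v2 r2; ring.
  have := mulr_ge0 (ltW vp) (sqr_ge0 v); have := mulr_ge0 (ltW vp) (ltW v0).
  have := mulr_ge0 (mulr_ge0 (ltW vp) (ltW vp)) (ltW v0).
  have := mulr_ge0 (ltW vp) (mulr_ge0 (mulr_ge0 (ltW vp) (ltW v0)) (ltW v0)).
  have := mulr_ge0 (ltW vp) (ltW vp).
  rewrite gammaE in g4; move: g4; lra.
have s4 : A * \sum_(1 <= k < N.+1) (v ^+ k)^-1 <= A * (Q * (8 / lambda)).
  apply: ler_wpM2l => //; apply: le_trans s1 _.
  by apply: ler_pM => //; rewrite ?invr_ge0 ?(ltW vN)// subr_ge0 ltW.
apply: le_trans s4 _.
have B0 : 0 <= A * (Q / lambda) by rewrite mulr_ge0// divr_ge0// ltW.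
have nme : 0 <= Bh * Ch / (nu * mu * epsilon) by rewrite divr_ge0 ?mulr_ge0 ?ltW.
have : A * (Q / lambda) <= 4 * Num.sqrt (Bh * Ch / (nu * mu * epsilon)).
  have s0 : 0 <= 4 * Num.sqrt (Bh * Ch / (nu * mu * epsilon)).
    by rewrite mulr_ge0 ?sqrtr_ge0.
  rewrite -ler_sqr ?nnegrE//.
  rewrite !exprMn exprVn !sqr_sqrtr ?(ltW q0)//; last first.
    by rewrite divr_ge0 ?mulr_ge0 ?ltW.
  rewrite -lambda_sqr le_eqVlt; apply/orP; left; apply/eqP.
  by field; rewrite !gt_eqF.
have -> : A * (Q * (8 / lambda)) = 8 * (A * (Q / lambda)) by ring.
lra.
Qed.

(** One factor 1 / (1 - r) comes from [X], a second from the geometric sum. As gamma = 1 - r^2 <= 2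
    (1 - r), nu mu = lambda^2 Lhat is at most 16 (1 - r)^2 Lhat. *)
Let sum_Ts_le : \sum_(1 <= k < N.+1) (Ts k)%:R
  <= N%:R + 32 * (sigma ^+ 2 / (nu * mu * epsilon)).
Proof.
have h := Lhat_gt0; have /andP[l20 l21] := @ln2_bounds R.
have Tk k : (1 <= k < N.+1)%N -> (Ts k)%:R <= 1 + X * r ^+ (N - k).
  move=> /andP[_ kN]; rewrite Ts_eq// addrC; apply: nceil_le.
  by rewrite mulr_ge0// exprn_ge0// ltW.
rewrite (le_trans (ler_sum_nat Tk))// big_split/= sumr_const_nat subSS subn0.
rewrite lerD2l -big_distrr/=.
have r01 : 0 <= r < 1 by rewrite (ltW r0) r1.
apply: le_trans (ler_wpM2l X_ge0 (sum_pow_le N r01)) _.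
have lr : lambda <= 4 * (1 - r).
  have -> : lambda = 2 * gamma by rewrite gammaE; field.
  have : gamma = 1 - r ^+ 2 by rewrite r2; ring.
  have := mulr_ge0 (ltW r1') (ltW r1'); lra.
have nm : nu * mu <= 16 * ((1 - r) ^+ 2 * Lhat).
  rewrite -lambda_sqr mulrA ler_pM2r//.
  have -> : 16 * (1 - r) ^+ 2 = (4 * (1 - r)) ^+ 2 by ring.
  by rewrite ler_sqr ?nnegrE ?(ltW lambda0)// mulr_ge0// ltW.
have -> : X / (1 - r) = 8 / 5 * (ln 2 * (1 - r ^+ N)) * (sigma ^+ 2 / epsilon)
    * ((1 - r) ^+ 2 * Lhat)^-1.
  by rewrite /X; field; rewrite !gt_eqF.
have -> : 32 * (sigma ^+ 2 / (nu * mu * epsilon))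
    = 2 * (sigma ^+ 2 / epsilon) * (16 * (nu * mu)^-1).
  by field; rewrite !gt_eqF.
have se0 : 0 <= sigma ^+ 2 / epsilon by rewrite divr_ge0 ?sqr_ge0 ?ltW.
have l2r : 0 <= ln 2 * (1 - r ^+ N) by rewrite mulr_ge0 ?ltW.
have d0 : 0 < (1 - r) ^+ 2 * Lhat by rewrite mulr_gt0 ?exprn_gt0.
apply: ler_pM; rewrite ?invr_ge0 ?(ltW d0)//.
- by rewrite mulr_ge0// mulr_ge0.
- apply: ler_wpM2r => //.
  have : ln 2 * (1 - r ^+ N) <= 1.
    rewrite -[leRHS]mulr1; apply: ler_pM; rewrite ?(ltW l20) ?(ltW rN1)//.
    by rewrite gerBl exprn_ge0// ltW.
  lra.
- rewrite -[leRHS]invrK lef_pV2 ?posrE ?invr_gt0 ?mulr_gt0 ?invr_gt0//.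
  rewrite invfM invrK ler_pdivrMl//.
Qed.

(** The maximum is bounded by the sum of the two rules. The constant 128 = 4 x 32 is that of the
    square root term; the other two have 6 and 32. *)
Lemma sum_T_le : (\sum_(1 <= k < N.+1) T k)%:R
  <= 128 * (N%:R + Num.sqrt (Bh * Ch / (nu * mu * epsilon))
            + sigma ^+ 2 / (nu * mu * epsilon)).
Proof.
rewrite natr_sum.
have Tk k : (1 <= k < N.+1)%N -> (T k)%:R <= 5 + 4 * (A * (v ^+ k)^-1) + (Ts k)%:R.
  move=> _; apply: (@le_trans _ _ ((Tg k)%:R + (Ts k)%:R)).
    by rewrite -natrD ler_nat TE geq_max leq_addr leq_addl.
  by rewrite lerD2r Tg_le.
apply: le_trans (ler_sum_nat Tk) _.
rewrite 2!big_split/= sumr_const_nat subSS subn0 -2!big_distrr/=.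
have := sum_Ts_le; have := sum_v_le; have := ler0n R N.
have : 0 <= sigma ^+ 2 / (nu * mu * epsilon).
  by rewrite divr_ge0 ?sqr_ge0 ?mulr_ge0 ?ltW.
have := sqrtr_ge0 (Bh * Ch / (nu * mu * epsilon)).
rewrite -[5 *+ N]mulr_natr; lra.
Qed.

End Schedule.

Theorem theorem3 :
  (* C is the absolute constant of the three complexity bounds *)
  exists C : nat, forall (R : realType) (n : nat)
    (nrm : 'rV[R]_n -> R) (X : set 'rV[R]_n)
    (f h chi om : 'rV[R]_n -> R) (gf gom : 'rV[R]_n -> 'rV[R]_n)
    (heta : R -> 'rV[R]_n -> R) (gheta : R -> 'rV[R]_n -> 'rV[R]_n)
    (nu mu L Bh Ch sigma : R),
  is_norm nrm ->
  closed X -> convex_set (M := 'rV[R]_n) X ->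
  is_dgf nrm X nu om gom ->
  (forall x z, X x -> X z -> bregman om gom x z <= 2^-1 * nrm (x - z) ^+ 2) ->
  (* (i) *)
  convex_function (E := 'rV[R]_n) X chi ->
  0 < mu -> strongly_convex nrm X mu chi ->
  (* (ii) *)
  convex_function (E := 'rV[R]_n) X h ->
  0 < Bh -> 0 < Ch -> smooth_approx nrm X h heta gheta Bh Ch ->
  (* (iii) *)
  convex_function (E := 'rV[R]_n) X f ->
  is_gradient X f gf ->
  0 < L ->
  (forall x y, X x -> X y ->
    f x <= f y + dotp (gf y) (x - y) + L / 2 * nrm (x - y) ^+ 2) ->
  0 <= sigma ->
  let Psi := fun z => f z + h z + chi z in
  let Lhat : R := Num.max L (4 * nu * mu) in
  let lambda : R := Num.sqrt (nu * mu / Lhat) in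
  let gamma : R := lambda / 2 in
  let beta : R := Lhat * gamma / nu in
  forall (x0 xstar : 'rV[R]_n) (Delta0 epsilon : R),
  is_argmin X Psi xstar ->
  0 < Delta0 ->
  Psi x0 - Psi xstar + lambda * (beta + mu) * bregman om gom x0 xstar <= Delta0 ->
  0 < epsilon -> epsilon < 8 * Delta0 ->
  let N := nceil (2 * ln (8 * Delta0 / epsilon) / - ln (1 - gamma)) in
  let eta : nat -> R := fun k => Delta0 / Bh * (1 - gamma) `^ (k%:R / 2) in
  let Leta : nat -> R := fun k => Ch / eta k in
  let Tg : nat -> nat := fun k =>
    nceil (ln (2^-1)
           / ln (1 - 4^-1 * Num.sqrt (Lhat / Num.max Lhat (Leta k)))) in
  let Ts : nat -> nat := fun k =>
    nceil (8 * sigma ^+ 2 * ln 2 * (1 - (1 - gamma) `^ (N%:R / 2))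
           / (5 * Lhat * epsilon * (1 - Num.sqrt (1 - gamma)))
           * (1 - gamma) `^ ((N%:R - k%:R) / 2)) in
  let T : nat -> nat := fun k => maxn (Tg k) (Ts k) in
  let alpha : nat -> R := fun k => 1 - 2 `^ (- (T k)%:R^-1) in
  let p : nat -> R := fun k => (1 - alpha k) / alpha k in
  forall (d d' : measure_display) (Omega : measurableType d)
    (Xi : measurableType d') (P : probability Omega R)
    (H : R -> 'rV[R]_n -> Xi -> 'rV[R]_n) (xi : nat -> nat -> Omega -> Xi)
    (x xbar xund : nat -> Omega -> 'rV[R]_n)
    (u util uund : nat -> nat -> Omega -> 'rV[R]_n),
  (forall w, RF_ASSGS X f gf heta H chi om gom
     (fun=> gamma) (fun=> lambda) (fun=> beta) eta
     (fun k _ => alpha k) (fun k _ => p k) (fun k _ => p k * mu) N T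
     (fun k t => xi k t w) x0
     (fun k => x k w) (fun k => xbar k w) (fun k => xund k w)
     (fun k t => u k t w) (fun k t => util k t w) (fun k t => uund k t w)) ->
  (* (iv) *)
  stochastic_oracle P nrm gheta H eta N T xi u uund sigma ->
  let Nf := N in
  let NH := (\sum_(1 <= k < N.+1) T k)%N in
  [/\ ('E_P[(fun w => Psi (xbar N w) - Psi xstar)%R] <= epsilon%:E)%E,
      Nf%:R <= C%:R * ((1 + Num.sqrt (L / (nu * mu)))
                       * (1 + ln (Num.max (Delta0 / epsilon) 1))),
      NH%:R <= C%:R * (Nf%:R + Num.sqrt (Bh * Ch / (nu * mu * epsilon))
                       + sigma ^+ 2 / (nu * mu * epsilon)) &
      sigma = 0 ->
      NH%:R <= C%:R * (Nf%:R + Num.sqrt (Bh * Ch / (nu * mu * epsilon)))].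
Proof.
exists 128%N => R n nrm X f h chi om gf gom heta gheta nu mu L Bh Ch sigma.
move=> nrmP _ convX omP Vle cchi mu0 schi _ Bh0 Ch0 sa cf gfP L0 smf _.
move=> Psi Lhat lambda gamma beta x0 xstar Delta0 epsilon xsP D0 hD e0 eD.
move=> N eta Leta Tg Ts T alpha p d d' Omega Xi P H xi x xbar xund u util uund alg so.
move=> Nf NH.
have nu0 : 0 < nu by case: omP.
have LhE : Lhat = Num.max L (4 * nu * mu) by [].
have lE : lambda = Num.sqrt (nu * mu / Lhat) by [].
have gE : gamma = lambda / 2 by [].
have bE : beta = Lhat * gamma / nu by [].
have NE : N = nceil (2 * ln (8 * Delta0 / epsilon) / - ln (1 - gamma)) by [].
have etaE k : eta k = Delta0 / Bh * (1 - gamma) `^ (k%:R / 2) by [].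
have TgE k : Tg k = nceil (ln (2^-1)
  / ln (1 - 4^-1 * Num.sqrt (Lhat / Num.max Lhat (Ch / eta k)))) by [].
have TsE k : Ts k =
  nceil (8 * sigma ^+ 2 * ln 2 * (1 - (1 - gamma) `^ (N%:R / 2))
    / (5 * Lhat * epsilon * (1 - Num.sqrt (1 - gamma)))
    * (1 - gamma) `^ ((N%:R - k%:R) / 2)) by [].
have TE k : T k = maxn (Tg k) (Ts k) by [].
have aE k : alpha k = 1 - 2 `^ (- (T k)%:R^-1) by [].
have pE k : p k = (1 - alpha k) / alpha k by [].
(* From here on the parameters are known only through their defining equations, which keeps them
   from being unfolded. *)
clearbody p alpha T Ts Tg Leta eta N beta gamma lambda Lhat.
have NfE := N_le nu0 mu0 L0 D0 e0 eD LhE lE gE NE.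
have NHE := sum_T_le nu0 mu0 L0 Bh0 Ch0 D0 e0 eD LhE lE gE NE etaE TgE TsE TE.
split.
- apply: le_trans (expectation_le nrmP convX omP Vle cchi mu0 schi Bh0 sa cf gfP L0 smf
    xsP (Lhat_gt0 L0 LhE) (L_le_Lhat LhE) (lambda_itv nu0 mu0 L0 LhE lE) gE
    (beta_nu nu0 bE) (beta_ge0 nu0 mu0 L0 LhE lE gE bE)
    (contraction_cond nu0 mu0 L0 LhE lE gE bE)
    (eta_gt0 nu0 mu0 L0 Bh0 D0 LhE lE gE etaE)
    (eta_noninc nu0 mu0 L0 Bh0 D0 LhE lE gE etaE)
    (alpha_gt0 L0 LhE TgE TE aE) (alpha_le4 L0 LhE TgE TE aE)
    (alpha_lipschitz nu0 mu0 L0 Bh0 Ch0 D0 LhE lE gE etaE TgE TE aE)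
    (p_alpha L0 LhE TgE TE aE pE) (alpha_pow L0 LhE TgE TE aE) alg so hD) _.
  rewrite lee_fin.
  exact: (gap_bound_le nu0 mu0 L0 Bh0 D0 e0 eD LhE lE gE NE etaE TgE TsE TE aE).
- apply: le_trans NfE _; rewrite ler_wpM2r ?ler_nat//.
  by rewrite mulr_ge0 ?addr_ge0 ?sqrtr_ge0// ln_ge0// le_max lexx orbT.
- exact: NHE.
- move=> s0; apply: le_trans NHE _.
  by rewrite s0 expr0n/= mul0r addr0.
Qed.
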